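(* Let $b\ge2$ be an integer. For every real $\alpha>0$ with $\alpha\ne1$ and every $z\ge0$, \[ \sum_{n=1}^{+\infty}s_{b}(n)\left(\frac{1}{(z+n)^{\alpha}}-\frac{1}{(z+n+1)^{\alpha}}\right)=\zeta(\alpha,1+z)+(1-b)\sum_{l=1}^{+\infty}\frac{1}{b^{l\alpha}}\zeta\left(\alpha,1+\frac{z}{b^l}\right). \]
   Context: $s_b(n)$ is the sum of the base-$b$ digits of $n$. $\zeta(\alpha,a)=\sum_{n\ge0}(a+n)^{-\alpha}$ is the Hurwitz zeta function (analytically continued for $0<\alpha<1$). *)

(* Defs.v *)
From Stdlib Require Import Reals List Arith ClassicalEpsilon.
From Coquelicot Require Import Coquelicot.

Open Scope R_scope.

(* The digit of b^i in the base-b expansion of n is (n / b^i) mod b. For b >= 2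
   it vanishes when i >= n, as then n < b^i, so positions 0, ..., n suffice. *)
Definition digit_sum (b n : nat) : nat :=
  list_sum (map (fun i => ((n / b ^ i) mod b)%nat) (seq 0 (S n))).

(* x^s = exp (s ln x) for x > 0 and s complex *)
Definition Rcpow (x : R) (s : C) : C :=
  (RtoC (Rpower x (Re s)) * (cos (Im s * ln x), sin (Im s * ln x)))%C.

Definition analytic_at (f : C -> C) (s0 : C) : Prop :=
  exists (c : nat -> C) (r : R), 0 < r /\
    forall s : C, Cmod (s - s0)%C < r ->
      is_series (V := C_NormedModule) (fun k => (c k * (s - s0) ^ k)%C) (f s).

(* f continues s |-> sum_{n >= 0} (a + n)^(-s) analytically from Re s > 1 to
   the connected domain {Re s > 0} \ {1}. This determines f on that domain and
   leaves its other values free. *)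
Definition is_hurwitz_zeta (a : R) (f : C -> C) : Prop :=
  (forall s : C, 1 < Re s ->
     is_series (V := C_NormedModule) (fun n => Rcpow (a + INR n) (- s)%C) (f s))
  /\ (forall s : C, 0 < Re s -> s <> RtoC 1 -> analytic_at f s).

Definition hurwitz_zeta_C (a : R) : C -> C :=
  epsilon (inhabits (fun _ : C => RtoC 0)) (is_hurwitz_zeta a).

(* For a > 0, alpha > 0 and alpha <> 1 the value at alpha is real, so Re only
   changes its type. *)
Definition hurwitz_zeta (alpha a : R) : R := Re (hurwitz_zeta_C a (RtoC alpha)).

(* Main.v *)
Require Import Defs.
From Stdlib Require Import Reals List Arith ClassicalEpsilon Lra Lia.
From Coquelicot Require Import Coquelicot.

Open Scope R_scope.

(* The value zeta(alpha, a) is the limit of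
     A_N = sum_{n < N} (a+n)^(-alpha) + (a+N)^(1-alpha) / (alpha-1),
   and A_N <= zeta(alpha, a) <= A_N + (a+N)^(-alpha), because A_N increases and
   A_N + (a+N)^(-alpha) decreases.  That this limit is the value of the analytic
   continuation needs two facts.  Existence: the series of the functions
     (s-1) x^(-s) - x^(1-s) + (x+1)^(1-s),   x = a+n,
   converges in the Banach algebra of power series absolutely convergent on a
   small closed disc around any s0 with Re s0 > 0, the n-th norm being
   O(n^(-1-Re s0+r)).  Uniqueness: on the segment from 2+i to alpha the difference
   of two continuations is real-analytic and vanishes near 2+i.

   The digit sum formula s_b(n) = n - (b-1) sum_{l >= 1} floor(n/b^l) and Abel
   summation turn the partial sum over n < b^L into partial sums of the Hurwitz
   series at 1 + z/b^l, with b^(L-l) terms each.  In their asymptotic expansions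
   the terms of order b^(L(1-alpha)) cancel and the errors add up to
   O(L b^(-L alpha)).  As the left-hand terms are nonnegative, it is enough to let
   n run to b^L. *)

(** * Series of complex numbers *)

(** [hurwitz_zeta] is picked by [epsilon], so all that is known about it is [is_hurwitz_zeta], and
    this only once some continuation has been exhibited. [analytic_at] asks for a power series
    expansion; the norm on coefficients therefore replaces locally uniform convergence: products and
    sums of expansions get explicit bounds, and a series of analytic functions becomes an exchange
    of two absolutely convergent sums. The factor s - 1 keeps the pole out until one final division.
    Points a >= 1 suffice, since only a = 1 + z/b^l occurs, and they make every logarithm
    nonnegative. The cancellation has a single cause: the endpoint z + b^l b^(L-l) = z + b^L is the
    same for every l. Each l thus contributes one common quantity V divided by b^l, with weights 1
    for l = 0 and -(b-1) for l >= 1 up to a common sign. As (b-1) sum_{l=1}^{L} b^(-l) = 1 - b^(-L),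
    only V b^(-L) survives, which is of order b^(-L alpha). *)

Local Notation Cseries := (is_series (V := C_NormedModule)).

Lemma is_series_ext_R (a b : nat -> R) (l : R) :
  (forall n, a n = b n) -> is_series a l -> is_series b l.
Proof. exact (is_series_ext (V := R_NormedModule) a b l). Qed.

Lemma Re_sum_n (a : nat -> C) (N : nat) :
  Re (sum_n (G := C_NormedModule) a N) = sum_n (fun n => Re (a n)) N.
Proof.
  induction N as [|N IH].
  - now rewrite !sum_O.
  - rewrite !sum_Sn, <- IH. reflexivity.
Qed.

Lemma Im_sum_n (a : nat -> C) (N : nat) :
  Im (sum_n (G := C_NormedModule) a N) = sum_n (fun n => Im (a n)) N.
Proof.
  induction N as [|N IH].
  - now rewrite !sum_O.
  - rewrite !sum_Sn, <- IH. reflexivity.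
Qed.

(** Balls in C are products of real balls, so convergence is componentwise by unfolding, with no
    norm estimate. *)
Lemma Cseries_components (a : nat -> C) (l : C) :
  Cseries a l <->
  is_series (fun n => Re (a n)) (Re l) /\ is_series (fun n => Im (a n)) (Im l).
Proof.
  unfold is_series.
  split.
  - intros H. split.
    + apply (filterlim_ext (fun N => Re (sum_n (G := C_NormedModule) a N))).
      { intros N. apply Re_sum_n. }
      intros P [e He]. apply (H (fun z => P (Re z))).
      exists e. intros y [Hy _]. now apply He.
    + apply (filterlim_ext (fun N => Im (sum_n (G := C_NormedModule) a N))).
      { intros N. apply Im_sum_n. }
      intros P [e He]. apply (H (fun z => P (Im z))).
      exists e. intros y [_ Hy]. now apply He.
  - intros [H1 H2] P [e He].
    pose proof (H1 _ (locally_ball (Re l) e)) as F1.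
    pose proof (H2 _ (locally_ball (Im l) e)) as F2.
    unfold filtermap in F1, F2 |- *.
    generalize (filter_and (F := eventually) _ _ F1 F2).
    apply filter_imp. intros N [B1 B2]. apply He. split.
    + rewrite <- Re_sum_n in B1. exact B1.
    + rewrite <- Im_sum_n in B2. exact B2.
Qed.

Lemma im_le_Cmod (c : C) : Rabs (Im c) <= Cmod c.
Proof.
  eapply Rle_trans; [apply Rmax_r | apply (Rmax_Cmod c)].
Qed.

Lemma sum_n_nonneg (a : nat -> R) (N : nat) :
  (forall n, 0 <= a n) -> 0 <= sum_n a N.
Proof.
  intros H. induction N as [|N IH].
  - rewrite sum_O. apply H.
  - rewrite sum_Sn. apply Rplus_le_le_0_compat; auto.
Qed.

Lemma sum_n_le (a b : nat -> R) (N : nat) :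
  (forall n, a n <= b n) -> sum_n a N <= sum_n b N.
Proof.
  intros H. induction N as [|N IH].
  - rewrite !sum_O. apply H.
  - rewrite !sum_Sn. apply Rplus_le_compat; auto.
Qed.

Lemma ex_series_bounded (a : nat -> R) (M : R) :
  (forall n, 0 <= a n) -> (forall N, sum_n a N <= M) -> ex_series a.
Proof.
  intros H0 HM.
  destruct (ex_finite_lim_seq_incr (sum_n a) M) as [l Hl].
  - intros N. rewrite sum_Sn. unfold plus; simpl. specialize (H0 (S N)). lra.
  - exact HM.
  - exists l. exact Hl.
Qed.

Lemma is_series_le_bound (a : nat -> R) (l M : R) :
  is_series a l -> (forall N, sum_n a N <= M) -> l <= M.
Proof.
  intros Hl HM.
  exact (is_lim_seq_le (sum_n a) (fun _ => M) l M HM Hl (is_lim_seq_const M)).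
Qed.

Lemma Series_le_bound (a : nat -> R) (M : R) :
  (forall n, 0 <= a n) -> (forall N, sum_n a N <= M) -> Series a <= M.
Proof.
  intros H0 HM. apply is_series_le_bound with a; auto.
  apply Series_correct. now apply ex_series_bounded with M.
Qed.

Lemma sum_n_le_Series (a : nat -> R) (N : nat) :
  (forall n, 0 <= a n) -> ex_series a -> sum_n a N <= Series a.
Proof.
  intros H0 Ha.
  apply (is_lim_seq_incr_compare (sum_n a) (Series a)).
  - apply Series_correct, Ha.
  - intros n. rewrite sum_Sn. unfold plus; simpl. specialize (H0 (S n)). lra.
Qed.

Lemma term_le_sum_n (a : nat -> R) (N : nat) :
  (forall n, 0 <= a n) -> a N <= sum_n a N.
Proof.
  intros H0. destruct N as [|N].
  - rewrite sum_O. lra.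
  - rewrite sum_Sn. unfold plus; simpl. pose proof (sum_n_nonneg a N H0). lra.
Qed.

Lemma ex_series_dominated (a b : nat -> R) :
  (forall n, Rabs (a n) <= b n) -> ex_series b -> ex_series a.
Proof.
  intros H Hb. exact (ex_series_le a b H Hb).
Qed.

Lemma Cseries_dominated (a : nat -> C) (b : nat -> R) :
  (forall n, Cmod (a n) <= b n) -> ex_series b -> exists l, Cseries a l.
Proof.
  intros H Hb.
  exists (Series (fun n => Re (a n)), Series (fun n => Im (a n))).
  apply Cseries_components; simpl; split; apply Series_correct;
    apply ex_series_dominated with b; auto; intros n;
    (eapply Rle_trans; [|apply H]); [apply re_le_Cmod | apply im_le_Cmod].
Qed.

Lemma Cmod_sum_n (a : nat -> C) (N : nat) :
  Cmod (sum_n (G := C_NormedModule) a N) <= sum_n (fun n => Cmod (a n)) N.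
Proof.
  induction N as [|N IH].
  - rewrite !sum_O. lra.
  - rewrite !sum_Sn. eapply Rle_trans; [apply Cmod_triangle|].
    apply Rplus_le_compat_r, IH.
Qed.

Lemma Cseries_bound (a : nat -> C) (l : C) (M : R) :
  Cseries a l -> (forall N, sum_n (fun n => Cmod (a n)) N <= M) -> Cmod l <= M.
Proof.
  intros Hl HM.
  apply (is_lim_seq_le (fun N => Cmod (sum_n (G := C_NormedModule) a N))
           (fun _ => M) (Cmod l) M).
  - intros N. eapply Rle_trans; [apply Cmod_sum_n | apply HM].
  - unfold is_lim_seq. apply filterlim_comp with (1 := Hl).
    exact (filterlim_norm (V := C_NormedModule) l).
  - apply is_lim_seq_const.
Qed.

Lemma Cseries_unique (a : nat -> C) (l1 l2 : C) :
  Cseries a l1 -> Cseries a l2 -> l1 = l2.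
Proof.
  intros H1 H2.
  apply Cseries_components in H1. apply Cseries_components in H2.
  destruct H1 as [A1 B1], H2 as [A2 B2].
  apply is_series_unique in A1. apply is_series_unique in A2.
  apply is_series_unique in B1. apply is_series_unique in B2.
  rewrite A1 in A2. rewrite B1 in B2.
  destruct l1, l2; simpl in *; congruence.
Qed.

Lemma sum_n_Series_switch (a : nat -> nat -> R) (K : nat) :
  (forall k, ex_series (fun n => a n k)) ->
  is_series (fun n => sum_n (fun k => a n k) K)
    (sum_n (fun k => Series (fun n => a n k)) K).
Proof.
  intros H. induction K as [|K IH].
  - rewrite sum_O. apply is_series_ext with (fun n => a n 0%nat).
    + intros n. now rewrite sum_O.
    + now apply Series_correct.
  - rewrite sum_Sn.
    apply is_series_ext with (fun n => plus (sum_n (fun k => a n k) K) (a n (S K))).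
    + intros n. now rewrite sum_Sn.
    + exact (is_series_plus (V := R_NormedModule) _ _ _ _ IH (Series_correct _ (H (S K)))).
Qed.

(* Dominated convergence for the partial sums over k of the n-th rows. *)
Lemma Series_Series_switch (a : nat -> nat -> R) (B : nat -> R) :
  (forall n K, sum_n (fun k => Rabs (a n k)) K <= B n) -> ex_series B ->
  is_series (fun k => Series (fun n => a n k))
    (Series (fun n => Series (fun k => a n k))).
Proof.
  intros HB exB.
  assert (Habs0 : forall n k, 0 <= Rabs (a n k)) by (intros; apply Rabs_pos).
  assert (Hak : forall n k, Rabs (a n k) <= B n).
  { intros n k. eapply Rle_trans; [|apply (HB n k)].
    apply (term_le_sum_n (fun k => Rabs (a n k))). intros; apply Rabs_pos. }
  assert (exrow : forall n, ex_series (fun k => a n k)).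
  { intros n. apply ex_series_Rabs. apply ex_series_bounded with (B n); auto. }
  assert (excol : forall k, ex_series (fun n => a n k)).
  { intros k. apply ex_series_dominated with B; auto. }
  (* [T n K] is the remainder of row n after index K. It tends to 0 for each n and is at most
     [2 * B n]; the claim becomes that its sum over n tends to 0 with K. *)
  set (T := fun n K => Series (fun k => a n k) - sum_n (fun k => a n k) K).
  assert (HT0 : forall n, is_lim_seq (T n) 0).
  { intros n. unfold T.
    replace (Finite 0) with (Finite (Series (fun k => a n k) - Series (fun k => a n k)))
      by (f_equal; ring).
    apply is_lim_seq_minus'; [apply is_lim_seq_const|].
    exact (Series_correct _ (exrow n)). }
  assert (Hpart : forall n K, Rabs (sum_n (fun k => a n k) K) <= B n).
  { intros n K. eapply Rle_trans; [|apply (HB n K)].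
    exact (norm_sum_n_m (fun k => a n k) 0 K). }
  assert (Hrow : forall n, Rabs (Series (fun k => a n k)) <= B n).
  { intros n. eapply Rle_trans; [apply Series_Rabs|].
    - apply ex_series_bounded with (B n); auto.
    - apply Series_le_bound; auto. }
  assert (HTB : forall n K, Rabs (T n K) <= 2 * B n).
  { intros n K. unfold T. pose proof (Hpart n K). pose proof (Hrow n).
    pose proof (Rabs_triang (Series (fun k => a n k)) (- sum_n (fun k => a n k) K)).
    rewrite Rabs_Ropp in H1. unfold Rminus. lra. }
  assert (exrows : ex_series (fun n => Series (fun k => a n k))).
  { apply ex_series_dominated with B; auto. }
  assert (ex2B : ex_series (fun n => 2 * B n)).
  { destruct exB as [l Hl]. exists (scal 2 l). exact (is_series_scal 2 B l Hl). }
  assert (HST : forall K, Series (fun n => T n K) =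
     Series (fun n => Series (fun k => a n k)) - sum_n (fun k => Series (fun n => a n k)) K).
  { intros K. apply is_series_unique.
    apply (is_series_minus _ _ _ _ (Series_correct _ exrows) (sum_n_Series_switch a K excol)). }
  enough (Hlim : is_lim_seq (fun K => Series (fun n => T n K)) 0).
  { set (S0 := Series (fun n => Series (fun k => a n k))) in *.
    change (is_lim_seq (sum_n (fun k => Series (fun n => a n k))) S0).
    apply (is_lim_seq_ext (fun K => S0 - Series (fun n => T n K))).
    { intros K. rewrite HST. ring. }
    replace (Finite S0) with (Finite (S0 - 0)) by (f_equal; ring).
    apply is_lim_seq_minus'; [apply is_lim_seq_const | exact Hlim]. }
  (* First N is fixed so that the rows beyond N contribute less than eps/2 through [2 * B], for all
     K at once; then K is taken large enough for the finitely many remaining rows. *)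
  apply is_lim_seq_spec. intros eps.
  assert (Htail := Series_correct _ ex2B).
  apply (is_lim_seq_spec (sum_n (fun n => 2 * B n)) (Series (fun n => 2 * B n))) in Htail.
  destruct (Htail (mkposreal _ (is_pos_div_2 eps))) as [N HN].
  specialize (HN N (le_n N)). simpl in HN.
  assert (Hhead : is_lim_seq (fun K => sum_n (fun n => Rabs (T n K)) N) 0).
  { clear HN. induction N as [|N IH].
    - apply (is_lim_seq_ext (fun K => Rabs (T 0%nat K))).
      + intros K. now rewrite sum_O.
      + replace (Finite 0) with (Rbar_abs 0) by (simpl; f_equal; apply Rabs_R0).
        now apply is_lim_seq_abs.
    - apply (is_lim_seq_ext (fun K => sum_n (fun n => Rabs (T n K)) N + Rabs (T (S N) K))).
      + intros K. now rewrite sum_Sn.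
      + replace 0 with (0 + Rabs 0) by (rewrite Rabs_R0; ring).
        apply is_lim_seq_plus'; [exact IH|].
        apply (is_lim_seq_abs (T (S N)) 0), HT0. }
  apply is_lim_seq_spec in Hhead.
  destruct (Hhead (mkposreal _ (is_pos_div_2 eps))) as [K0 HK0].
  exists K0. intros K HK. specialize (HK0 K HK). simpl in HK0.
  rewrite Rminus_0_r in *.
  assert (exT : ex_series (fun n => Rabs (T n K))).
  { apply ex_series_dominated with (fun n => 2 * B n); auto.
    intros n. rewrite Rabs_Rabsolu. apply HTB. }
  eapply Rle_lt_trans; [now apply Series_Rabs|].
  rewrite (Series_incr_n _ (S N)); auto; [|lia].
  rewrite (Series_incr_n _ (S N)) in HN; auto; [|lia].
  simpl pred in *. rewrite <- !sum_n_Reals in *.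
  assert (Hle : Series (fun k => Rabs (T (S N + k)%nat K)) <=
                Series (fun k => 2 * B (S N + k)%nat)).
  { apply Series_le.
    - intros n. split; [apply Rabs_pos | apply HTB].
    - now apply (ex_series_incr_n (fun n => 2 * B n) (S N)). }
  rewrite Rabs_pos_eq in HK0 by (apply sum_n_nonneg; intros; apply Rabs_pos).
  rewrite Rabs_minus_sym in HN.
  apply Rabs_def2 in HN. lra.
Qed.

Lemma Cseries_Cseries_switch (a : nat -> nat -> C) (B : nat -> R) (row col : nat -> C) (l : C) :
  (forall n K, sum_n (fun k => Cmod (a n k)) K <= B n) -> ex_series B ->
  (forall n, Cseries (fun k => a n k) (row n)) ->
  (forall k, Cseries (fun n => a n k) (col k)) ->
  Cseries row l -> Cseries col l.
Proof.
  intros HB exB Hrow Hcol Hl.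
  apply Cseries_components in Hl. destruct Hl as [HlR HlI].
  apply Cseries_components. split.
  - rewrite <- (is_series_unique _ _ HlR).
    rewrite (Series_ext _ (fun n => Series (fun k => Re (a n k)))).
    + apply is_series_ext with (fun k => Series (fun n => Re (a n k))).
      * intros k. apply is_series_unique, (proj1 (proj1 (Cseries_components _ _) (Hcol k))).
      * apply Series_Series_switch with B; auto. intros n K.
        eapply Rle_trans; [apply sum_n_le | apply (HB n K)].
        intros k. apply re_le_Cmod.
    + intros n. symmetry.
      apply is_series_unique, (proj1 (proj1 (Cseries_components _ _) (Hrow n))).
  - rewrite <- (is_series_unique _ _ HlI).
    rewrite (Series_ext _ (fun n => Series (fun k => Im (a n k)))).
    + apply is_series_ext with (fun k => Series (fun n => Im (a n k))).
      * intros k. apply is_series_unique, (proj2 (proj1 (Cseries_components _ _) (Hcol k))).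
      * apply Series_Series_switch with B; auto. intros n K.
        eapply Rle_trans; [apply sum_n_le | apply (HB n K)].
        intros k. apply im_le_Cmod.
    + intros n. symmetry.
      apply is_series_unique, (proj2 (proj1 (Cseries_components _ _) (Hrow n))).
Qed.

(** * The complex exponential *)

(** The inequality is strict, so the terms are bounded at the larger radius |x| + 1. *)
Lemma CV_radius_entire (a : nat -> R) (x : R) :
  (forall r, ex_series (fun n => Rabs (a n * r ^ n))) ->
  Rbar_lt (Rabs x) (CV_radius a).
Proof.
  intros H.
  apply Rbar_lt_le_trans with (Finite (Rabs x + 1)); [simpl; lra|].
  apply (proj1 (CV_radius_bounded a)).
  exists (Series (fun n => Rabs (a n * (Rabs x + 1) ^ n))). intros n.
  eapply Rle_trans; [|apply (sum_n_le_Series _ n)]; auto using Rabs_pos.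
  apply (term_le_sum_n (fun n => Rabs (a n * (Rabs x + 1) ^ n))).
  intros; apply Rabs_pos.
Qed.

Lemma exp_series (x : R) : is_series (fun n => x ^ n / INR (fact n)) (exp x).
Proof.
  generalize (proj1 (is_pseries_R _ _ _) (is_exp_Reals x)).
  apply (is_series_ext (V := R_NormedModule)). intros n.
  apply Rmult_comm.
Qed.

Lemma exp_partial_sum_le (x : R) (N : nat) :
  0 <= x -> sum_n (fun n => x ^ n / INR (fact n)) N <= exp x.
Proof.
  intros Hx. rewrite <- (is_series_unique _ _ (exp_series x)).
  apply sum_n_le_Series.
  - intros n. apply Rle_mult_inv_pos; [now apply pow_le | apply INR_fact_lt_0].
  - eexists; apply exp_series.
Qed.

Definition Cexp (w : C) : C := (RtoC (exp (Re w)) * (cos (Im w), sin (Im w)))%C.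

Lemma Cexp_plus (w1 w2 : C) : Cexp (w1 + w2) = (Cexp w1 * Cexp w2)%C.
Proof.
  destruct w1 as [u1 v1], w2 as [u2 v2].
  unfold Cexp, Cmult, Cplus, RtoC; simpl.
  rewrite exp_plus, cos_plus, sin_plus. f_equal; ring.
Qed.

Lemma Cexp_RtoC (x : R) : Cexp (RtoC x) = RtoC (exp x).
Proof.
  unfold Cexp, Cmult, RtoC; simpl. rewrite cos_0, sin_0. f_equal; ring.
Qed.

Lemma Cmod_Cexp (w : C) : Cmod (Cexp w) = exp (Re w).
Proof.
  unfold Cexp. rewrite Cmod_mult, Cmod_R, Rabs_pos_eq by apply Rlt_le, exp_pos.
  unfold Cmod; simpl.
  replace (cos (Im w) * (cos (Im w) * 1) + sin (Im w) * (sin (Im w) * 1)) with 1.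
  - rewrite sqrt_1. ring.
  - pose proof (sin2_cos2 (Im w)) as H. unfold Rsqr in H. lra.
Qed.

(** Together with [exp_coef_Im]: the coefficients, in a real variable t, of the real and imaginary
    parts of exp(t w). Splitting w^n in this way brings the complex exponential within reach of real
    power series. *)
Definition exp_coef_Re (w : C) (n : nat) : R := Re (w ^ n) / INR (fact n).
Definition exp_coef_Im (w : C) (n : nat) : R := Im (w ^ n) / INR (fact n).

Lemma exp_coef_entire (w : C) (c : nat -> R) (x : R) :
  (forall n, Rabs (c n) <= Cmod w ^ n / INR (fact n)) ->
  Rbar_lt (Rabs x) (CV_radius c).
Proof.
  intros H. apply CV_radius_entire. intros r.
  apply ex_series_dominated with (fun n => (Cmod w * Rabs r) ^ n / INR (fact n)).
  - intros n. rewrite Rabs_Rabsolu, Rabs_mult, <- RPow_abs, Rpow_mult_distr.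
    unfold Rdiv in *. rewrite Rmult_assoc, (Rmult_comm (Rabs r ^ n)), <- Rmult_assoc.
    apply Rmult_le_compat_r; [apply pow_le, Rabs_pos | apply H].
  - eexists; apply exp_series.
Qed.

Lemma exp_coef_bound (w : C) (x : R) (n : nat) :
  Rabs x <= Cmod (w ^ n) -> Rabs (x / INR (fact n)) <= Cmod w ^ n / INR (fact n).
Proof.
  intros H. rewrite Cmod_pow in H. unfold Rdiv. rewrite Rabs_mult.
  rewrite (Rabs_pos_eq (/ INR (fact n))) by (apply Rlt_le, Rinv_0_lt_compat, INR_fact_lt_0).
  apply Rmult_le_compat_r; [apply Rlt_le, Rinv_0_lt_compat, INR_fact_lt_0 | exact H].
Qed.

Lemma exp_coef_entire_Re (w : C) (x : R) : Rbar_lt (Rabs x) (CV_radius (exp_coef_Re w)).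
Proof.
  apply exp_coef_entire with w. intros n. apply exp_coef_bound, re_le_Cmod.
Qed.

Lemma exp_coef_entire_Im (w : C) (x : R) : Rbar_lt (Rabs x) (CV_radius (exp_coef_Im w)).
Proof.
  apply exp_coef_entire with w. intros n. apply exp_coef_bound, im_le_Cmod.
Qed.

Lemma PSeries_lin_comb (c d : nat -> R) (u v x : R) :
  ex_pseries c x -> ex_pseries d x ->
  PSeries (fun n => u * c n + v * d n) x = u * PSeries c x + v * PSeries d x.
Proof.
  intros Hc Hd.
  apply is_pseries_unique, is_pseries_R.
  apply PSeries_correct, is_pseries_R in Hc.
  apply PSeries_correct, is_pseries_R in Hd.
  apply is_series_ext with
    (fun n => plus (scal u (c n * x ^ n)) (scal v (d n * x ^ n))).
  { intros n. unfold plus, scal; simpl. unfold mult; simpl. ring. }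
  exact (is_series_plus (V := R_NormedModule) _ _ _ _
    (is_series_scal (V := R_NormedModule) u _ _ Hc)
    (is_series_scal (V := R_NormedModule) v _ _ Hd)).
Qed.

(** Since w^(n+1) = w w^n, termwise differentiation multiplies the series of exp(x w) by w; this is
    the real part of that identity, and the next lemma is the imaginary part. *)
Lemma exp_series_derive_Re (w : C) (x : R) :
  is_derive (PSeries (exp_coef_Re w)) x
    (Re w * PSeries (exp_coef_Re w) x - Im w * PSeries (exp_coef_Im w) x).
Proof.
  replace (Re w * PSeries (exp_coef_Re w) x - Im w * PSeries (exp_coef_Im w) x)
    with (PSeries (PS_derive (exp_coef_Re w)) x).
  { apply is_derive_PSeries, exp_coef_entire_Re. }
  rewrite (PSeries_ext _ (fun n => Re w * exp_coef_Re w n + (- Im w) * exp_coef_Im w n)).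
  - rewrite PSeries_lin_comb.
    + ring.
    + apply CV_radius_inside, exp_coef_entire_Re.
    + apply CV_radius_inside, exp_coef_entire_Im.
  - intros n. unfold PS_derive, exp_coef_Re, exp_coef_Im.
    rewrite fact_simpl, mult_INR.
    change (Re (w ^ S n)) with (Re w * Re (w ^ n) - Im w * Im (w ^ n)).
    field. split; [apply INR_fact_neq_0 | now apply not_0_INR].
Qed.

Lemma exp_series_derive_Im (w : C) (x : R) :
  is_derive (PSeries (exp_coef_Im w)) x
    (Re w * PSeries (exp_coef_Im w) x + Im w * PSeries (exp_coef_Re w) x).
Proof.
  replace (Re w * PSeries (exp_coef_Im w) x + Im w * PSeries (exp_coef_Re w) x)
    with (PSeries (PS_derive (exp_coef_Im w)) x).
  { apply is_derive_PSeries, exp_coef_entire_Im. }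
  rewrite (PSeries_ext _ (fun n => Re w * exp_coef_Im w n + Im w * exp_coef_Re w n)).
  - apply PSeries_lin_comb.
    + apply CV_radius_inside, exp_coef_entire_Im.
    + apply CV_radius_inside, exp_coef_entire_Re.
  - intros n. unfold PS_derive, exp_coef_Re, exp_coef_Im.
    rewrite fact_simpl, mult_INR.
    change (Im (w ^ S n)) with (Re w * Im (w ^ n) + Im w * Re (w ^ n)).
    field. split; [apply INR_fact_neq_0 | now apply not_0_INR].
Qed.

(* [t |-> exp (t w)] and its power series solve the same linear differential
   equation, so their quotient is constant. *)
Lemma Cexp_series (w : C) : Cseries (fun n => (w ^ n / RtoC (INR (fact n)))%C) (Cexp w).
Proof.
  set (P := PSeries (exp_coef_Re w)). set (Q := PSeries (exp_coef_Im w)).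
  set (u := Re w). set (v := Im w).
  assert (dP : forall t, is_derive P t (u * P t - v * Q t)) by exact (exp_series_derive_Re w).
  assert (dQ : forall t, is_derive Q t (u * Q t + v * P t)) by exact (exp_series_derive_Im w).
  assert (DP : forall t, Derive (fun x : R => P x) t = u * P t - v * Q t).
  { intros t. apply is_derive_unique, dP. }
  assert (DQ : forall t, Derive (fun x : R => Q x) t = u * Q t + v * P t).
  { intros t. apply is_derive_unique, dQ. }
  assert (P0 : P 0 = 1).
  { unfold P. rewrite PSeries_0. unfold exp_coef_Re. simpl. field. }
  assert (Q0 : Q 0 = 0).
  { unfold Q. rewrite PSeries_0. unfold exp_coef_Im. simpl. field. }
  (* [G1] and [G2] are the real and imaginary parts of exp(-t w) (P t + i Q t); both have derivative
     0. *)
  set (G1 := fun t => exp (- (t * u)) * (cos (t * v) * P t + sin (t * v) * Q t)).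
  set (G2 := fun t => exp (- (t * u)) * (cos (t * v) * Q t - sin (t * v) * P t)).
  assert (H1 : G1 0 = G1 1).
  { apply (eq_is_derive G1 0 1); [|lra]. intros t _. unfold G1.
    auto_derive.
    - split; [eexists; apply dP|]. split; [eexists; apply dQ | trivial].
    - rewrite DP, DQ.
      unfold zero; simpl. ring. }
  assert (H2 : G2 0 = G2 1).
  { apply (eq_is_derive G2 0 1); [|lra]. intros t _. unfold G2.
    auto_derive.
    - split; [eexists; apply dQ|]. split; [eexists; apply dP | trivial].
    - rewrite DP, DQ.
      unfold zero; simpl. ring. }
  unfold G1, G2 in H1, H2.
  rewrite P0, Q0, !Rmult_0_l, !Rmult_1_l, Ropp_0, exp_0, cos_0, sin_0 in H1, H2.
  rewrite exp_Ropp in H1, H2.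
  assert (E := exp_pos u).
  assert (K1 : cos v * P 1 + sin v * Q 1 = exp u).
  { apply Rmult_eq_reg_l with (/ exp u); [|apply Rinv_neq_0_compat; lra].
    rewrite <- H1. field; lra. }
  assert (K2 : cos v * Q 1 - sin v * P 1 = 0).
  { apply Rmult_eq_reg_l with (/ exp u); [|apply Rinv_neq_0_compat; lra].
    rewrite <- H2. ring. }
  (* [K1] and [K2] say that (P 1, Q 1) rotated by the angle -v is (exp u, 0); rotating back gives
     [EP] and [EQ]. *)
  assert (T := sin2_cos2 v). unfold Rsqr in T.
  assert (EP : P 1 = exp u * cos v).
  { rewrite <- K1. transitivity (P 1 * (sin v * sin v + cos v * cos v)
      + sin v * (cos v * Q 1 - sin v * P 1)); [rewrite T, K2; ring|].
    transitivity ((cos v * P 1 + sin v * Q 1) * cos v); ring. }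
  assert (EQ : Q 1 = exp u * sin v).
  { rewrite <- K1. transitivity (Q 1 * (sin v * sin v + cos v * cos v)
      - cos v * (cos v * Q 1 - sin v * P 1)); [rewrite T, K2; ring|].
    ring. }
  assert (LR : forall (z : C) (n : nat),
     (z / RtoC (INR (fact n)))%C = (Re z / INR (fact n), Im z / INR (fact n))).
  { intros [x y] n. unfold Cdiv, Cmult, Cinv, RtoC; simpl.
    f_equal; field; apply INR_fact_neq_0. }
  apply Cseries_components. split.
  - replace (Re (Cexp w)) with (P 1).
    + assert (X := PSeries_correct _ _ (CV_radius_inside _ _ (exp_coef_entire_Re w 1))).
      apply is_pseries_R in X. revert X. apply is_series_ext.
      intros n. rewrite LR, pow1. simpl. unfold exp_coef_Re. ring.
    + rewrite EP. unfold Cexp, Cmult, RtoC; simpl. fold u v. ring.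
  - replace (Im (Cexp w)) with (Q 1).
    + assert (X := PSeries_correct _ _ (CV_radius_inside _ _ (exp_coef_entire_Im w 1))).
      apply is_pseries_R in X. revert X. apply is_series_ext.
      intros n. rewrite LR, pow1. simpl. unfold exp_coef_Im. ring.
    + rewrite EQ. unfold Cexp, Cmult, RtoC; simpl. fold u v. ring.
Qed.

(** * Power series with a bounded Wiener norm *)

Lemma Cseries_scal (c : C) (a : nat -> C) (l : C) :
  Cseries a l -> Cseries (fun n => (c * a n)%C) (c * l)%C.
Proof. exact (is_series_scal (V := C_NormedModule) c a l). Qed.

Lemma Cseries_plus (a b : nat -> C) (la lb : C) :
  Cseries a la -> Cseries b lb -> Cseries (fun n => (a n + b n)%C) (la + lb)%C.
Proof. exact (is_series_plus (V := C_NormedModule) a b la lb). Qed.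

Lemma Cseries_ext (a b : nat -> C) (l : C) :
  (forall n, a n = b n) -> Cseries a l -> Cseries b l.
Proof. exact (is_series_ext (V := C_NormedModule) a b l). Qed.

Lemma Cseries_cons (a : nat -> C) (l l' : C) :
  Cseries (fun n => a (S n)) l -> l' = (a 0%nat + l)%C -> Cseries a l'.
Proof.
  intros H ->. apply (is_series_decr_1 (V := C_NormedModule)).
  replace (plus _ _) with l; [exact H|].
  unfold plus, opp; simpl. ring.
Qed.

Lemma Cseries_tail (a : nat -> C) (l : C) :
  Cseries a l -> Cseries (fun n => a (S n)) (l - a 0%nat)%C.
Proof.
  intros H. apply (is_series_incr_1 (V := C_NormedModule)).
  replace (plus _ _) with l; [exact H|].
  unfold plus; simpl. ring.
Qed.

Lemma Cseries_zero : Cseries (fun _ => RtoC 0) (RtoC 0).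
Proof.
  apply Cseries_components; simpl.
  assert (H : is_series (fun _ : nat => 0) 0).
  { change (is_lim_seq (sum_n (fun _ : nat => 0)) 0).
    apply (is_lim_seq_ext (fun _ => 0)); [|apply is_lim_seq_const].
    intros n. rewrite sum_n_const. ring. }
  now split.
Qed.

(** Total, so that it can occur in the formula of a function with no convergence proof as argument;
    its value means something only through [Csum_correct]. *)
Definition Csum (a : nat -> C) : C :=
  (Series (fun n => Re (a n)), Series (fun n => Im (a n))).

Lemma Csum_correct (a : nat -> C) : (exists l, Cseries a l) -> Cseries a (Csum a).
Proof.
  intros [l Hl]. apply Cseries_components in Hl. apply Cseries_components; simpl.
  split; apply Series_correct; eexists; apply Hl.
Qed.

(* [M] bounds the norm of [f] in the Banach algebra of power series [c] with
   norm the sum of [|c_k| r^k]. *)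
Definition wiener (r : R) (f : C -> C) (M : R) : Prop :=
  exists c : nat -> C,
    (forall K, sum_n (fun k => Cmod (c k) * r ^ k) K <= M) /\
    forall w : C, Cmod w < r -> Cseries (fun k => (c k * w ^ k)%C) (f w).

Lemma wiener_analytic_at (f : C -> C) (s0 : C) (r M : R) :
  0 < r -> wiener r (fun w => f (s0 + w)%C) M -> analytic_at f s0.
Proof.
  intros Hr [c [_ Hc]]. exists c, r. split; [exact Hr|].
  intros s Hs. specialize (Hc _ Hs).
  now replace (s0 + (s - s0))%C with s in Hc by ring.
Qed.

Lemma wiener_ext (r : R) (f g : C -> C) (M : R) :
  (forall w, Cmod w < r -> f w = g w) -> wiener r f M -> wiener r g M.
Proof.
  intros H [c [Hb Hc]]. exists c. split; [exact Hb|].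
  intros w Hw. rewrite <- H; auto.
Qed.

Lemma wiener_mono (r : R) (f : C -> C) (M M' : R) :
  M <= M' -> wiener r f M -> wiener r f M'.
Proof.
  intros H [c [Hb Hc]]. exists c. split; [|exact Hc].
  intros K. now apply Rle_trans with M.
Qed.

Lemma wiener_bound (r : R) (f : C -> C) (M : R) (w : C) :
  Cmod w < r -> wiener r f M -> Cmod (f w) <= M.
Proof.
  intros Hw [c [Hb Hc]]. apply (Cseries_bound _ _ _ (Hc w Hw)). intros N.
  eapply Rle_trans; [|apply (Hb N)]. apply sum_n_le. intros k.
  rewrite Cmod_mult, Cmod_pow. apply Rmult_le_compat_l; [apply Cmod_ge_0|].
  apply pow_incr. split; [apply Cmod_ge_0 | lra].
Qed.

Lemma wiener_const (r : R) (z : C) : wiener r (fun _ => z) (Cmod z).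
Proof.
  exists (fun k => match k with O => z | _ => RtoC 0 end). split.
  - intros K. apply Req_le. induction K as [|K IH].
    + rewrite sum_O. simpl. ring.
    + rewrite sum_Sn, IH, Cmod_0. unfold plus; simpl. ring.
  - intros w _.
    apply Cseries_cons with (RtoC 0); [|simpl; ring].
    apply (Cseries_ext (fun _ => RtoC 0)); [|apply Cseries_zero].
    intros n. ring.
Qed.

Lemma sum_n_cons (a : nat -> R) (N : nat) :
  sum_n a (S N) = a 0%nat + sum_n (fun n => a (S n)) N.
Proof.
  induction N as [|N IH].
  - rewrite sum_Sn, !sum_O. reflexivity.
  - rewrite sum_Sn, IH, sum_Sn. unfold plus; simpl. ring.
Qed.

Lemma wiener_mult_var (r : R) (f : C -> C) (M : R) :
  0 < r -> wiener r f M -> wiener r (fun w => (w * f w)%C) (r * M).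
Proof.
  intros Hr [c [Hb Hc]].
  exists (fun k => match k with O => RtoC 0 | S k => c k end). split.
  - assert (HM : 0 <= M).
    { eapply Rle_trans; [|apply (Hb 0%nat)]. rewrite sum_O.
      apply Rmult_le_pos; [apply Cmod_ge_0 | apply pow_le; lra]. }
    intros [|K].
    + rewrite sum_O, Cmod_0, Rmult_0_l. apply Rmult_le_pos; lra.
    + rewrite sum_n_cons, Cmod_0, Rmult_0_l, Rplus_0_l.
      rewrite (sum_n_ext _ (fun k => mult r (Cmod (c k) * r ^ k))).
      * rewrite sum_n_mult_l. apply Rmult_le_compat_l; [lra | apply Hb].
      * intros k. unfold mult; simpl. ring.
  - intros w Hw.
    apply Cseries_cons with (w * f w)%C; [|simpl; ring].
    eapply Cseries_ext; [|apply Cseries_scal, (Hc w Hw)].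
    intros n. simpl. ring.
Qed.

Lemma wiener_scal (r : R) (z : C) (f : C -> C) (M : R) :
  wiener r f M -> wiener r (fun w => (z * f w)%C) (Cmod z * M).
Proof.
  intros [c [Hb Hc]]. exists (fun k => (z * c k)%C). split.
  - intros K. rewrite (sum_n_ext _ (fun k => mult (Cmod z) (Cmod (c k) * r ^ k))).
    + rewrite sum_n_mult_l. apply Rmult_le_compat_l; [apply Cmod_ge_0 | apply Hb].
    + intros k. rewrite Cmod_mult. unfold mult; simpl. ring.
  - intros w Hw. eapply Cseries_ext; [|apply (Cseries_scal z), (Hc w Hw)].
    intros n. simpl. ring.
Qed.

Lemma wiener_plus (r : R) (f g : C -> C) (M M' : R) :
  0 < r -> wiener r f M -> wiener r g M' ->
  wiener r (fun w => (f w + g w)%C) (M + M').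
Proof.
  intros Hr [c [Hb Hc]] [d [Hb' Hd]]. exists (fun k => (c k + d k)%C). split.
  - intros K. eapply Rle_trans; [apply (sum_n_le _
      (fun k => plus (Cmod (c k) * r ^ k) (Cmod (d k) * r ^ k)))|].
    + intros k. unfold plus; simpl. rewrite <- Rmult_plus_distr_r.
      apply Rmult_le_compat_r; [apply pow_le; lra | apply Cmod_triangle].
    + rewrite sum_n_plus. apply Rplus_le_compat; auto.
  - intros w Hw. eapply Cseries_ext; [|apply Cseries_plus; [apply (Hc w Hw)|apply (Hd w Hw)]].
    intros n. simpl. ring.
Qed.

(** Completeness of the algebra. The k-th coefficient of F is the sum over n of the k-th
    coefficients of [f n], and the domination by B allows the sums over n and k to be exchanged. *)
Lemma wiener_series (r : R) (f : nat -> C -> C) (B : nat -> R) (F : C -> C) :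
  0 < r -> (forall n, wiener r (f n) (B n)) -> ex_series B ->
  (forall w, Cmod w < r -> Cseries (fun n => f n w) (F w)) ->
  wiener r F (Series B).
Proof.
  intros Hr Hf exB HF.
  (* [wiener] only asserts that an expansion exists, so one is chosen for every n simultaneously. *)
  set (c := fun n => proj1_sig (constructive_indefinite_description _ (Hf n))).
  assert (Hc : forall n, (forall K, sum_n (fun k => Cmod (c n k) * r ^ k) K <= B n) /\
     forall w : C, Cmod w < r -> Cseries (fun k => (c n k * w ^ k)%C) (f n w)).
  { intros n. exact (proj2_sig (constructive_indefinite_description _ (Hf n))). }
  clearbody c.
  assert (Hpos : forall n k, 0 <= Cmod (c n k) * r ^ k).
  { intros n k. apply Rmult_le_pos; [apply Cmod_ge_0 | apply pow_le; lra]. }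
  assert (Hterm : forall n k, Cmod (c n k) * r ^ k <= B n).
  { intros n k. eapply Rle_trans; [|apply (proj1 (Hc n) k)].
    now apply (term_le_sum_n (fun k => Cmod (c n k) * r ^ k)). }
  assert (exterm : forall k, ex_series (fun n => Cmod (c n k) * r ^ k)).
  { intros k. apply ex_series_dominated with B; [|exact exB].
    intros n. rewrite Rabs_pos_eq; auto. }
  assert (excmod : forall k, ex_series (fun n => Cmod (c n k))).
  { intros k. destruct (exterm k) as [l Hl]. exists (l * / r ^ k).
    apply (is_series_scal_r (/ r ^ k)) in Hl. revert Hl. apply is_series_ext_R.
    intros n. field. apply pow_nonzero; lra. }
  set (col := fun k => Csum (fun n => c n k)).
  assert (Hcol : forall k, Cseries (fun n => c n k) (col k)).
  { intros k. apply Csum_correct.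
    apply Cseries_dominated with (fun n => Cmod (c n k)); auto using Rle_refl. }
  exists col. split.
  - intros K.
    apply Rle_trans with (sum_n (fun k => Series (fun n => Cmod (c n k) * r ^ k)) K).
    + apply sum_n_le. intros k. rewrite Series_scal_r.
      apply Rmult_le_compat_r; [apply pow_le; lra|].
      apply (Cseries_bound _ _ _ (Hcol k)). intros N.
      apply sum_n_le_Series; auto using Cmod_ge_0.
    + rewrite <- (is_series_unique _ _
        (sum_n_Series_switch (fun n k => Cmod (c n k) * r ^ k) K exterm)).
      apply Series_le; [|exact exB]. intros n. split.
      * now apply sum_n_nonneg.
      * apply Hc.
  - intros w Hw.
    apply (Cseries_Cseries_switch (fun n k => (c n k * w ^ k)%C) B (fun n => f n w)); auto.
    + intros n K. eapply Rle_trans; [|apply (proj1 (Hc n) K)].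
      apply sum_n_le. intros k. rewrite Cmod_mult, Cmod_pow.
      apply Rmult_le_compat_l; [apply Cmod_ge_0|].
      apply pow_incr. split; [apply Cmod_ge_0 | lra].
    + intros n. now apply Hc.
    + intros k. rewrite Cmult_comm.
      apply (Cseries_ext (fun n => (w ^ k * c n k)%C)); [intros n; apply Cmult_comm|].
      apply Cseries_scal, Hcol.
Qed.

Lemma wiener_mult_monomial (r : R) (g : C -> C) (M : R) (k : nat) :
  0 < r -> wiener r g M -> wiener r (fun w => (w ^ k * g w)%C) (r ^ k * M).
Proof.
  intros Hr Hg. induction k as [|k IH].
  - simpl. rewrite Rmult_1_l. revert Hg. apply wiener_ext. intros w _. ring.
  - simpl. rewrite Rmult_assoc. generalize (wiener_mult_var _ _ _ Hr IH).
    apply wiener_ext. intros w _. ring.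
Qed.

(** No Cauchy product is formed: f g is the series over k of c_k w^k g(w), whose terms have norm at
    most |c_k| r^k M', and [wiener_series] sums it. *)
Lemma wiener_mult (r : R) (f g : C -> C) (M M' : R) :
  0 < r -> wiener r f M -> wiener r g M' ->
  wiener r (fun w => (f w * g w)%C) (M * M').
Proof.
  intros Hr [c [Hb Hc]] Hg.
  assert (HM' : 0 <= M').
  { apply Rle_trans with (Cmod (g 0%C)); [apply Cmod_ge_0|].
    apply (wiener_bound r); [rewrite Cmod_0; exact Hr | exact Hg]. }
  assert (Hpos : forall k, 0 <= Cmod (c k) * r ^ k).
  { intros k. apply Rmult_le_pos; [apply Cmod_ge_0 | apply pow_le; lra]. }
  assert (exc : ex_series (fun k => Cmod (c k) * r ^ k))
    by (apply ex_series_bounded with M; auto).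
  apply wiener_mono with (Series (fun k => Cmod (c k) * r ^ k * M')).
  { rewrite Series_scal_r. apply Rmult_le_compat_r; [exact HM'|].
    now apply Series_le_bound. }
  apply (wiener_series r (fun k w => (c k * (w ^ k * g w))%C)); auto.
  - intros k. rewrite Rmult_assoc.
    now apply wiener_scal, wiener_mult_monomial.
  - destruct exc as [l Hl]. exists (l * M'). now apply is_series_scal_r.
  - intros w Hw. rewrite Cmult_comm.
    eapply Cseries_ext; [|apply (Cseries_scal (g w)), (Hc w Hw)].
    intros n. simpl. ring.
Qed.

Lemma wiener_pow (r : R) (f : C -> C) (M : R) (k : nat) :
  0 < r -> wiener r f M -> wiener r (fun w => (f w ^ k)%C) (M ^ k).
Proof.
  intros Hr Hf. induction k as [|k IH].
  - simpl. assert (X := wiener_const r 1). rewrite Cmod_1 in X. exact X.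
  - simpl. now apply wiener_mult.
Qed.

Lemma wiener_linear (r : R) (z c : C) :
  0 < r -> wiener r (fun w => (z + c * w)%C) (Cmod z + Cmod c * r).
Proof.
  intros Hr. apply wiener_plus; [exact Hr | apply wiener_const |].
  apply wiener_scal.
  replace r with (r * Cmod 1) at 2 by (rewrite Cmod_1; ring).
  generalize (wiener_mult_var r _ _ Hr (wiener_const r 1)).
  apply wiener_ext. intros w _. ring.
Qed.

Lemma wiener_exp (r : R) (z : C) :
  0 < r -> wiener r (fun w => Cexp (z * w)) (exp (Cmod z * r)).
Proof.
  intros Hr. exists (fun k => (z ^ k / RtoC (INR (fact k)))%C). split.
  - intros K. eapply Rle_trans; [|apply (exp_partial_sum_le (Cmod z * r) K)].
    + apply sum_n_le. intros k.
      assert (F := INR_fact_lt_0 k).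
      rewrite Cmod_div, Cmod_pow, Cmod_R, Rabs_pos_eq, Rpow_mult_distr by
        (try (intros E; apply RtoC_inj in E); lra).
      apply Req_le. unfold Rdiv. ring.
    + apply Rmult_le_pos; [apply Cmod_ge_0 | lra].
  - intros w _. eapply Cseries_ext; [|apply Cexp_series].
    intros k. simpl. rewrite Cpow_mult_l. unfold Cdiv. ring.
Qed.

Lemma Cseries_geom (q : C) : Cmod q < 1 -> Cseries (fun k => (q ^ k)%C) (/ (1 - q))%C.
Proof.
  intros Hq.
  assert (Hq1 : (1 - q)%C <> 0).
  { intros E. assert (q = 1)%C by (transitivity (1 - (1 - q))%C; [ring | rewrite E; ring]).
    subst q. rewrite Cmod_1 in Hq. lra. }
  assert (exq : ex_series (fun k => Cmod q ^ k)).
  { apply ex_series_geom. rewrite Rabs_pos_eq; [exact Hq | apply Cmod_ge_0]. }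
  destruct (Cseries_dominated (fun k => (q ^ k)%C) (fun k => Cmod q ^ k)) as [l Hl]; auto.
  { intros k. rewrite Cmod_pow. apply Rle_refl. }
  (* Multiplying the geometric series by q drops its first term. *)
  assert (E : (q * l)%C = (l - 1)%C).
  { apply (Cseries_unique (fun k => (q ^ S k)%C)).
    - apply (Cseries_scal q _ _ Hl).
    - exact (Cseries_tail _ _ Hl). }
  assert (E2 : @eq C (/ (1 - q))%C l).
  { transitivity ((l - q * l) / (1 - q))%C; [rewrite E|]; field; exact Hq1. }
  rewrite E2. exact Hl.
Qed.

(** 1/(z+w) is expanded geometrically in -w/z; the norm is the same series in r/|z|, with sum
    1/(|z|-r). It serves to divide by s - 1 away from the pole. *)
Lemma wiener_inv (r : R) (z : C) :
  0 < r < Cmod z -> wiener r (fun w => (/ (z + w))%C) (/ (Cmod z - r)).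
Proof.
  intros [Hr Hz].
  assert (Hz0 : z <> 0%C) by (apply Cmod_gt_0; lra).
  exists (fun k => (/ z * (- / z) ^ k)%C). split.
  - intros K.
    assert (Hq : Rabs (r / Cmod z) < 1).
    { rewrite Rabs_pos_eq; [apply Rmult_lt_reg_r with (Cmod z); [lra|]; field_simplify; lra|].
      apply Rle_mult_inv_pos; lra. }
    assert (G := is_series_geom _ Hq).
    replace (/ (Cmod z - r)) with (Series (fun k => / Cmod z * (r / Cmod z) ^ k)).
    + eapply Rle_trans; [|apply sum_n_le_Series].
      * apply sum_n_le. intros k.
        rewrite Cmod_mult, Cmod_pow, Cmod_opp, Cmod_inv by exact Hz0.
        unfold Rdiv. rewrite Rpow_mult_distr. apply Req_le. ring.
      * intros k. apply Rmult_le_pos; [apply Rlt_le, Rinv_0_lt_compat; lra|].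
        apply pow_le, Rle_mult_inv_pos; lra.
      * eexists. apply (is_series_scal (V := R_NormedModule) (/ Cmod z)), G.
    + apply is_series_unique.
      replace (/ (Cmod z - r)) with (scal (/ Cmod z) (/ (1 - r / Cmod z)));
        [exact (is_series_scal (V := R_NormedModule) (/ Cmod z) _ _ G)|].
      unfold scal; simpl; unfold mult; simpl. field. lra.
  - intros w Hw.
    assert (Hq : Cmod (- w / z) < 1).
    { rewrite Cmod_div, Cmod_opp by exact Hz0.
      apply Rmult_lt_reg_r with (Cmod z); [lra|]. field_simplify; lra. }
    assert (G := Cseries_scal (/ z) _ _ (Cseries_geom _ Hq)).
    replace (/ (z + w))%C with (/ z * / (1 - - w / z))%C.
    + revert G. apply Cseries_ext. intros k. rewrite <- Cmult_assoc, <- Cpow_mult_l.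
      do 2 f_equal. unfold Cdiv. ring.
    + assert (z + w <> 0)%C.
      { intros E. assert (w = - z)%C by (transitivity (z + w - z)%C; [ring | rewrite E; ring]).
        subst w. rewrite Cmod_opp in Hw. lra. }
      field. repeat split; auto.
Qed.

(** * Sums of real powers *)

(** Exactly N terms, possibly none, where [sum_n] has N + 1. Blocks of b^(L-l) terms and telescoping
    sums need this count. *)
Fixpoint psum (f : nat -> R) (N : nat) : R :=
  match N with O => 0 | S N => psum f N + f N end.

Lemma psum_sum_n (f : nat -> R) (N : nat) : psum f (S N) = sum_n f N.
Proof.
  induction N as [|N IH].
  - rewrite sum_O. simpl. ring.
  - rewrite sum_Sn, <- IH. reflexivity.
Qed.

Lemma is_series_psum (f : nat -> R) (l : R) :
  is_series f l <-> is_lim_seq (psum f) l.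
Proof.
  rewrite is_lim_seq_incr_1. split; intros H.
  - apply (is_lim_seq_ext (sum_n f)); [|exact H].
    intros N. symmetry. apply psum_sum_n.
  - change (is_lim_seq (sum_n f) l). revert H. apply is_lim_seq_ext, psum_sum_n.
Qed.

Lemma Rpower_pos (x y : R) : 0 < Rpower x y.
Proof. apply exp_pos. Qed.

Lemma Rpower_decr (x y p : R) :
  0 <= p -> 0 < x -> x <= y -> Rpower y (- p) <= Rpower x (- p).
Proof.
  intros Hp Hx Hxy. rewrite !Rpower_Ropp.
  apply Rinv_le_contravar; [apply Rpower_pos|].
  now apply Rle_Rpower_l.
Qed.

Lemma is_lim_seq_Rpower_opp (a p : R) :
  0 < p -> 0 < a -> is_lim_seq (fun n => Rpower (a + INR n) (- p)) 0.
Proof.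
  intros Hp Ha. apply is_lim_seq_spec. intros eps.
  (* The threshold: (a+n)^(-p) < eps exactly when ln(a+n) > -(ln eps)/p. *)
  destruct (nfloor_ex (exp (- ln eps / p)) (Rlt_le _ _ (exp_pos _))) as [N0 [_ HN0]].
  exists (S N0). intros n Hn. rewrite Rminus_0_r, Rabs_pos_eq by apply Rlt_le, Rpower_pos.
  unfold Rpower. replace (pos eps) with (exp (ln eps)) by apply exp_ln, cond_pos.
  apply exp_increasing.
  assert (H : - ln eps / p < ln (a + INR n)).
  { rewrite <- (ln_exp (- ln eps / p)). apply ln_increasing; [apply exp_pos|].
    apply le_INR in Hn. rewrite S_INR in Hn. lra. }
  apply (Rmult_lt_compat_l p) in H; [|exact Hp].
  replace (p * (- ln eps / p)) with (- ln eps) in H by (field; lra). lra.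
Qed.

(* Comparison of [x^(-alpha)] with the integral of [t^(-alpha)] over [x, x+1]. *)
Lemma Rpower_integral_comparison (x alpha : R) :
  0 < x -> 0 < alpha -> alpha <> 1 ->
  0 <= Rpower x (- alpha)
       + (Rpower (x + 1) (1 - alpha) - Rpower x (1 - alpha)) / (alpha - 1)
    <= Rpower x (- alpha) - Rpower (x + 1) (- alpha).
Proof.
  intros Hx Ha Ha1.
  destruct (MVT_gen (fun t => Rpower t (1 - alpha)) x (x + 1)
              (fun t => (1 - alpha) * Rpower t (1 - alpha - 1))) as [c [Hc E]].
  - intros t. rewrite Rmin_left, Rmax_right by lra. intros Ht.
    apply is_derive_Reals, derivable_pt_lim_power. lra.
  - intros t. rewrite Rmin_left, Rmax_right by lra. intros Ht.
    apply derivable_continuous_pt. eexists. apply derivable_pt_lim_power. lra.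
  - rewrite Rmin_left, Rmax_right in Hc by lra.
    rewrite E. replace (1 - alpha - 1) with (- alpha) by ring.
    replace ((1 - alpha) * Rpower c (- alpha) * (x + 1 - x) / (alpha - 1))
      with (- Rpower c (- alpha)) by (field; lra).
    assert (Rpower c (- alpha) <= Rpower x (- alpha)) by (apply Rpower_decr; lra).
    assert (Rpower (x + 1) (- alpha) <= Rpower c (- alpha)) by (apply Rpower_decr; lra).
    lra.
Qed.

(** The A_N of the overview. For alpha > 1 the last summand is the integral of t^(-alpha) over [a+N,
    +oo); the same formula in alpha serves below 1. *)
Definition hurwitz_approx (alpha a : R) (N : nat) : R :=
  psum (fun n => Rpower (a + INR n) (- alpha)) N
  + Rpower (a + INR N) (1 - alpha) / (alpha - 1).

Lemma hurwitz_approx_step (alpha a : R) (N : nat) :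
  0 < a -> 0 < alpha -> alpha <> 1 ->
  hurwitz_approx alpha a N <= hurwitz_approx alpha a (S N)
  <= hurwitz_approx alpha a N
     + (Rpower (a + INR N) (- alpha) - Rpower (a + INR (S N)) (- alpha)).
Proof.
  intros Ha Hal Hal1. unfold hurwitz_approx. simpl psum.
  assert (Hx : 0 < a + INR N) by (pose proof (pos_INR N); lra).
  pose proof (Rpower_integral_comparison _ alpha Hx Hal Hal1) as H.
  rewrite S_INR. rewrite <- Rplus_assoc.
  unfold Rdiv in *. rewrite Rmult_minus_distr_r in H. lra.
Qed.

Lemma hurwitz_approx_sandwich (alpha a : R) (N K : nat) :
  0 < a -> 0 < alpha -> alpha <> 1 ->
  hurwitz_approx alpha a N <= hurwitz_approx alpha a (N + K)
  <= hurwitz_approx alpha a N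
     + (Rpower (a + INR N) (- alpha) - Rpower (a + INR (N + K)) (- alpha)).
Proof.
  intros Ha Hal Hal1. induction K as [|K IH].
  - rewrite Nat.add_0_r. lra.
  - rewrite Nat.add_succ_r.
    pose proof (hurwitz_approx_step alpha a (N + K) Ha Hal Hal1). lra.
Qed.

Lemma hurwitz_approx_limit_bounds (alpha a l : R) (N : nat) :
  0 < a -> 0 < alpha -> alpha <> 1 -> is_lim_seq (hurwitz_approx alpha a) l ->
  hurwitz_approx alpha a N <= l <= hurwitz_approx alpha a N + Rpower (a + INR N) (- alpha).
Proof.
  intros Ha Hal Hal1 Hl.
  apply (is_lim_seq_incr_n _ N) in Hl. split.
  - refine (is_lim_seq_le (fun _ => hurwitz_approx alpha a N) _
      (hurwitz_approx alpha a N) l _ (is_lim_seq_const _) Hl).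
    intros K. rewrite Nat.add_comm. now apply hurwitz_approx_sandwich.
  - refine (is_lim_seq_le _ (fun _ => hurwitz_approx alpha a N + Rpower (a + INR N) (- alpha))
      l (hurwitz_approx alpha a N + Rpower (a + INR N) (- alpha)) _ Hl (is_lim_seq_const _)).
    intros K. rewrite Nat.add_comm.
    pose proof (hurwitz_approx_sandwich alpha a N K Ha Hal Hal1).
    pose proof (Rpower_pos (a + INR (N + K)) (- alpha)). lra.
Qed.

(** The sandwich started at 0 acts as an integral test: for p > 1 the end term of [hurwitz_approx]
    is nonnegative, so dropping it bounds the partial sums. *)
Lemma ex_series_Rpower (a p : R) :
  0 < a -> 1 < p -> ex_series (fun n => Rpower (a + INR n) (- p)).
Proof.
  intros Ha Hp.
  apply ex_series_bounded with (hurwitz_approx p a 0 + Rpower a (- p)).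
  - intros n. apply Rlt_le, Rpower_pos.
  - intros N. rewrite <- psum_sum_n.
    pose proof (hurwitz_approx_sandwich p a 0 (S N) Ha) as [_ H]; [lra | lra |].
    rewrite Nat.add_0_l in H. change (INR 0) with 0 in H. rewrite Rplus_0_r in H.
    unfold hurwitz_approx at 1 in H.
    assert (0 <= Rpower (a + INR (S N)) (1 - p) / (p - 1)).
    { apply Rle_mult_inv_pos; [apply Rlt_le, Rpower_pos | lra]. }
    pose proof (Rpower_pos (a + INR (S N)) (- p)). lra.
Qed.

(** * Existence of the continuation of the Hurwitz zeta function *)

Lemma Rcpow_Cexp (x : R) (s : C) : Rcpow x s = Cexp (s * RtoC (ln x)).
Proof.
  destruct s as [u v]. unfold Rcpow, Cexp, Rpower, RtoC, Cmult; simpl.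
  rewrite !Rmult_0_r, Rminus_0_r, Rplus_0_l. f_equal; ring.
Qed.

Lemma Cmod_Rcpow (x : R) (s : C) : Cmod (Rcpow x s) = Rpower x (Re s).
Proof.
  rewrite Rcpow_Cexp, Cmod_Cexp. unfold Rpower, Cmult, RtoC, Re; simpl. f_equal. ring.
Qed.

Lemma Rcpow_RtoC (x y : R) : Rcpow x (RtoC y) = RtoC (Rpower x y).
Proof. rewrite Rcpow_Cexp, <- RtoC_mult. apply Cexp_RtoC. Qed.

Lemma Rcpow_plus (x : R) (s t : C) : Rcpow x (s + t) = (Rcpow x s * Rcpow x t)%C.
Proof. rewrite !Rcpow_Cexp, <- Cexp_plus. f_equal. ring. Qed.

(** Here 1 <= x is decisive: |ln x| = ln x, so that x^(-w) has norm at most exp(r ln x) = x^r. *)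
Lemma wiener_Rcpow (r x : R) (s0 : C) :
  0 < r -> 1 <= x ->
  wiener r (fun w => Rcpow x (s0 - w)) (Rpower x (Re s0 + r)).
Proof.
  intros Hr Hx.
  assert (HL : 0 <= ln x) by (rewrite <- ln_1; apply ln_le; lra).
  rewrite Rpower_plus, <- Cmod_Rcpow.
  replace (Rpower x r) with (exp (Cmod (- RtoC (ln x)) * r)).
  - generalize (wiener_scal r (Rcpow x s0) _ _ (wiener_exp r (- RtoC (ln x)) Hr)).
    apply wiener_ext. intros w _.
    rewrite !Rcpow_Cexp, <- Cexp_plus. f_equal. ring.
  - unfold Rpower. rewrite Cmod_opp, Cmod_R, Rabs_pos_eq by exact HL.
    f_equal. ring.
Qed.

(** The exponential series without its first two terms. In the term of index k + 2, d^k <= 1 and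
    (k+2)! >= k! leave d^2 Q^2 times Q^k/k!, which sums to the stated bound. *)
Lemma wiener_exp_remainder (r d Q : R) (f : C -> C) :
  0 < r -> 0 <= d <= 1 -> wiener r f Q ->
  wiener r (fun w => (Cexp (f w * RtoC d) - 1 - f w * RtoC d)%C) (d ^ 2 * (Q ^ 2 * exp Q)).
Proof.
  intros Hr Hd Hf.
  assert (HQ : 0 <= Q).
  { apply Rle_trans with (Cmod (f 0%C)); [apply Cmod_ge_0|].
    apply (wiener_bound r); [rewrite Cmod_0; exact Hr | exact Hf]. }
  set (B := fun k => d ^ 2 * Q ^ 2 * (Q ^ k / INR (fact k))).
  assert (HB : is_series B (d ^ 2 * (Q ^ 2 * exp Q))).
  { rewrite <- Rmult_assoc.
    exact (is_series_scal (V := R_NormedModule) (d ^ 2 * Q ^ 2) _ _ (exp_series Q)). }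
  rewrite <- (is_series_unique _ _ HB).
  apply (wiener_series r
    (fun k w => (RtoC (d ^ S (S k) / INR (fact (S (S k)))) * f w ^ S (S k))%C)).
  - exact Hr.
  - intros k.
    apply wiener_mono with
      (Cmod (RtoC (d ^ S (S k) / INR (fact (S (S k))))) * Q ^ S (S k)).
    + assert (F := INR_fact_lt_0 k). assert (F2 := INR_fact_lt_0 (S (S k))).
      assert (FF : INR (fact k) <= INR (fact (S (S k)))) by (apply le_INR, fact_le; lia).
      rewrite Cmod_R, Rabs_pos_eq by (apply Rle_mult_inv_pos; [apply pow_le; lra | lra]).
      unfold B, Rdiv.
      apply Rle_trans with (d ^ S (S k) * / INR (fact k) * Q ^ S (S k)).
      * apply Rmult_le_compat_r; [now apply pow_le|].
        apply Rmult_le_compat_l; [apply pow_le; lra|].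
        now apply Rinv_le_contravar.
      * replace (d ^ S (S k) * / INR (fact k) * Q ^ S (S k)) with
          (d ^ k * (d ^ 2 * Q ^ 2 * (Q ^ k * / INR (fact k)))) by (simpl; ring).
        rewrite <- (Rmult_1_l (d ^ 2 * Q ^ 2 * (Q ^ k * / INR (fact k)))) at 2.
        apply Rmult_le_compat_r.
        -- apply Rmult_le_pos; [apply Rmult_le_pos; apply pow2_ge_0|].
           apply Rle_mult_inv_pos; [now apply pow_le | lra].
        -- rewrite <- (pow1 k). apply pow_incr. lra.
    + apply wiener_scal. now apply wiener_pow.
  - eexists; exact HB.
  - intros w _.
    assert (X := Cseries_tail _ _ (Cseries_tail _ _ (Cexp_series (f w * RtoC d)))).
    match type of X with is_series _ ?l =>
      replace (Cexp (f w * RtoC d) - 1 - f w * RtoC d)%C with l end.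
    + revert X. apply Cseries_ext. intros k.
      rewrite Cpow_mult_l, RtoC_div, RtoC_pow by apply INR_fact_neq_0.
      unfold Cdiv. ring.
    + simpl. field.
Qed.

(** Both sides rest on 1 + t <= exp t, taken at t = ln((x+1)/x) and at t = ln(x/(x+1)). *)
Lemma ln_succ_bounds (x : R) :
  1 <= x -> 0 <= / x - (ln (x + 1) - ln x) <= / x ^ 2 /\ 0 <= ln (x + 1) - ln x <= / x.
Proof.
  intros Hx.
  assert (U : ln (x + 1) - ln x <= / x).
  { rewrite <- ln_div by lra.
    pose proof (exp_ineq1_le (ln ((x + 1) / x))) as H.
    rewrite exp_ln in H by (apply Rdiv_lt_0_compat; lra).
    replace ((x + 1) / x) with (1 + / x) in * by (field; lra). lra. }
  assert (L : ln x - ln (x + 1) <= - / (x + 1)).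
  { rewrite <- ln_div by lra.
    pose proof (exp_ineq1_le (ln (x / (x + 1)))) as H.
    rewrite exp_ln in H by (apply Rdiv_lt_0_compat; lra).
    replace (x / (x + 1)) with (1 - / (x + 1)) in * by (field; lra). lra. }
  assert (0 < / (x + 1)) by (apply Rinv_0_lt_compat; lra).
  assert (/ x - / (x + 1) <= / x ^ 2).
  { replace (/ x - / (x + 1)) with (/ (x * (x + 1))) by (field; lra).
    apply Rinv_le_contravar; nra. }
  lra.
Qed.

(* [s - 1] times the difference between [x^(-s)] and the integral of [t^(-s)]
   over [x, x+1]. *)
Definition hurwitz_term (x : R) (s : C) : C :=
  ((s - 1) * Rcpow x (- s) - Rcpow x (1 - s) + Rcpow (x + 1) (1 - s))%C.

(** Isolates the second-order cancellation: both summands in the bracket have order x^(-2), the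
    exponential remainder because d <= 1/x and the other because |d - 1/x| <= 1/x^2. *)
Lemma hurwitz_term_factor (x : R) (s : C) :
  1 <= x ->
  let d := ln (x + 1) - ln x in
  hurwitz_term x s =
  (Rcpow x (1 - s) * ((Cexp ((1 - s) * RtoC d) - 1 - (1 - s) * RtoC d)
                      + RtoC (d - / x) * (1 - s)))%C.
Proof.
  intros Hx d. unfold hurwitz_term.
  replace (Rcpow x (- s)) with (Rcpow x (1 - s) * RtoC (/ x))%C.
  - replace (Rcpow (x + 1) (1 - s)) with (Rcpow x (1 - s) * Cexp ((1 - s) * RtoC d))%C.
    + rewrite RtoC_minus. ring.
    + rewrite !Rcpow_Cexp, <- Cexp_plus. f_equal. unfold d. rewrite RtoC_minus. ring.
  - replace (/ x) with (Rpower x (Ropp 1)).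
    + rewrite <- Rcpow_RtoC, <- Rcpow_plus. f_equal.
      rewrite RtoC_opp. ring.
    + rewrite Rpower_Ropp, Rpower_1 by lra. reflexivity.
Qed.

(** The exponent is x^(1 - Re s0 + r) from the power times x^(-2) from the bracket. D does not
    depend on x, and the bound is summable along x = a + n once r < Re s0. *)
Lemma hurwitz_term_wiener (r : R) (s0 : C) :
  0 < r -> exists D, forall x, 1 <= x ->
  wiener r (fun w => hurwitz_term x (s0 + w)) (D * Rpower x (- (1 + Re s0 - r))).
Proof.
  intros Hr. set (Q := Cmod (1 - s0) + r).
  assert (HQ : 0 <= Q) by (unfold Q; pose proof (Cmod_ge_0 (1 - s0)); lra).
  (* Q bounds the norm of 1 - s on the disc; the two summands of D come from the exponential
     remainder and from the linear correction. *)
  exists (Q ^ 2 * exp Q + Q). intros x Hx.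
  pose proof (ln_succ_bounds x Hx) as [H1 H2].
  set (d := ln (x + 1) - ln x) in *.
  assert (Hx2 : 0 < / x ^ 2) by (apply Rinv_0_lt_compat, pow_lt; lra).
  assert (Hix : / x <= 1) by (rewrite <- Rinv_1; apply Rinv_le_contravar; lra).
  assert (W1 : wiener r (fun w => (1 - (s0 + w))%C) Q).
  { replace Q with (Cmod (1 - s0) + Cmod (- (1)) * r)
      by (unfold Q; rewrite Cmod_opp, Cmod_1; ring).
    generalize (wiener_linear r (1 - s0) (- (1)) Hr).
    apply wiener_ext. intros w _. ring. }
  assert (W2 : wiener r (fun w => ((Cexp ((1 - (s0 + w)) * RtoC d) - 1 - (1 - (s0 + w)) * RtoC d)
                      + RtoC (d - / x) * (1 - (s0 + w)))%C)
                 (d ^ 2 * (Q ^ 2 * exp Q) + Cmod (RtoC (d - / x)) * Q)).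
  { apply wiener_plus; [exact Hr | |now apply wiener_scal].
    apply (wiener_exp_remainder r d Q (fun w => (1 - (s0 + w))%C)); auto. lra. }
  assert (W3 := wiener_mult _ _ _ _ _ Hr (wiener_Rcpow r x (1 - s0) Hr Hx) W2).
  apply wiener_mono with
    (Rpower x (Re (1 - s0) + r) * (d ^ 2 * (Q ^ 2 * exp Q) + Cmod (RtoC (d - / x)) * Q)).
  - assert (Hd2 : d ^ 2 <= / x ^ 2).
    { rewrite <- pow_inv by lra. apply pow_incr. lra. }
    assert (Hdx : Cmod (RtoC (d - / x)) <= / x ^ 2).
    { rewrite Cmod_R, Rabs_left1; lra. }
    replace (Rpower x (- (1 + Re s0 - r))) with (Rpower x (Re (1 - s0) + r) * / x ^ 2).
    + assert (0 <= Q ^ 2 * exp Q).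
      { apply Rmult_le_pos; [apply pow2_ge_0 | apply Rlt_le, exp_pos]. }
      rewrite (Rmult_comm (_ + _)), Rmult_assoc.
      apply Rmult_le_compat_l; [apply Rlt_le, Rpower_pos|].
      rewrite Rmult_plus_distr_l.
      apply Rplus_le_compat; now apply Rmult_le_compat_r.
    + rewrite <- (Rpower_pow 2), <- Rpower_Ropp, <- Rpower_plus by lra.
      f_equal. destruct s0; simpl. ring.
  - revert W3. apply wiener_ext. intros w _.
    rewrite (hurwitz_term_factor x (s0 + w) Hx). fold d.
    do 2 f_equal. ring.
Qed.

(** For Re s > 1 the differences of x^(1-s) inside the terms telescope to -a^(1-s). Adding a^(1-s)
    back makes the numerator (s-1) zeta(s,a), in a form that converges for Re s > 0. *)
Definition hurwitz_continuation (a : R) (s : C) : C :=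
  ((Rcpow a (1 - s) + Csum (fun n => hurwitz_term (a + INR n) s)) / (s - 1))%C.

Lemma hurwitz_term_series_wiener (a r : R) (s0 : C) :
  1 <= a -> 0 < r < Re s0 ->
  exists M, wiener r (fun w => Csum (fun n => hurwitz_term (a + INR n) (s0 + w))) M.
Proof.
  intros Ha [Hr Hr0]. destruct (hurwitz_term_wiener r s0 Hr) as [D HD].
  set (B := fun n => D * Rpower (a + INR n) (- (1 + Re s0 - r))).
  assert (exB : ex_series B).
  { destruct (ex_series_Rpower a (1 + Re s0 - r)) as [l Hl]; [lra | lra |].
    exists (D * l). exact (is_series_scal (V := R_NormedModule) D _ _ Hl). }
  assert (HB : forall n, wiener r (fun w => hurwitz_term (a + INR n) (s0 + w)) (B n)).
  { intros n. apply HD. pose proof (pos_INR n). lra. }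
  exists (Series B).
  apply (wiener_series r (fun n w => hurwitz_term (a + INR n) (s0 + w))); auto.
  intros w Hw. apply Csum_correct.
  apply Cseries_dominated with B; [|exact exB].
  intros n. exact (wiener_bound r _ _ w Hw (HB n)).
Qed.

Lemma hurwitz_term_series (a : R) (s : C) :
  1 <= a -> 0 < Re s ->
  Cseries (fun n => hurwitz_term (a + INR n) s)
    (Csum (fun n => hurwitz_term (a + INR n) s)).
Proof.
  intros Ha Hs. apply Csum_correct.
  assert (Hr : 0 < Re s / 2) by lra.
  destruct (hurwitz_term_wiener (Re s / 2) s Hr) as [D HD].
  apply Cseries_dominated with (fun n => D * Rpower (a + INR n) (- (1 + Re s - Re s / 2))).
  - intros n.
    assert (Hn : 1 <= a + INR n) by (pose proof (pos_INR n); lra).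
    assert (H0 : Cmod 0 < Re s / 2) by (rewrite Cmod_0; exact Hr).
    generalize (wiener_bound _ _ _ 0 H0 (HD _ Hn)). now rewrite Cplus_0_r.
  - destruct (ex_series_Rpower a (1 + Re s - Re s / 2)) as [l Hl]; [lra | lra |].
    exists (D * l). exact (is_series_scal (V := R_NormedModule) D _ _ Hl).
Qed.

Lemma hurwitz_continuation_analytic (a : R) (s0 : C) :
  1 <= a -> 0 < Re s0 -> s0 <> RtoC 1 -> analytic_at (hurwitz_continuation a) s0.
Proof.
  intros Ha Hs Hs1.
  assert (H1 : 0 < Cmod (s0 - 1)).
  { apply Cmod_gt_0. intros E. apply Hs1.
    transitivity (s0 - 1 + 1)%C; [ring | rewrite E; ring]. }
  (* Below Re s0 for the summability of the terms, below |s0 - 1| for the inverse of s - 1. *)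
  set (r := Rmin (Re s0) (Cmod (s0 - 1)) / 2).
  assert (Hr : 0 < r /\ r < Re s0 /\ r < Cmod (s0 - 1)).
  { unfold r. pose proof (Rmin_l (Re s0) (Cmod (s0 - 1))).
    pose proof (Rmin_r (Re s0) (Cmod (s0 - 1))).
    assert (0 < Rmin (Re s0) (Cmod (s0 - 1))) by now apply Rmin_glb_lt. lra. }
  destruct Hr as [Hr [Hr0 Hr1]].
  destruct (hurwitz_term_series_wiener a r s0 Ha (conj Hr Hr0)) as [M HM].
  eapply (wiener_analytic_at _ _ r); [exact Hr|].
  generalize (wiener_mult _ _ _ _ _ Hr
    (wiener_plus _ _ _ _ _ Hr (wiener_Rcpow r a (1 - s0) Hr Ha) HM)
    (wiener_inv r (s0 - 1) (conj Hr Hr1))).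
  apply wiener_ext. intros w _. unfold hurwitz_continuation, Cdiv.
  f_equal; [do 2 f_equal | f_equal]; ring.
Qed.

Lemma is_series_telescope (b : nat -> R) :
  is_lim_seq b 0 -> is_series (fun n => b (S n) - b n) (- b 0%nat).
Proof.
  intros Hb. apply is_series_psum.
  apply (is_lim_seq_ext (fun n => b n - b 0%nat)).
  - intros n. induction n as [|n IH]; simpl; [ring | rewrite <- IH; ring].
  - replace (Finite (- b 0%nat)) with (Finite (0 - b 0%nat)) by (f_equal; ring).
    apply is_lim_seq_minus'; [exact Hb | apply is_lim_seq_const].
Qed.

Lemma is_lim_seq_dominated (u v : nat -> R) :
  (forall n, Rabs (u n) <= v n) -> is_lim_seq v 0 -> is_lim_seq u 0.
Proof.
  intros H Hv. apply is_lim_seq_abs_0.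
  apply (is_lim_seq_le_le (fun _ => 0) _ v); auto using is_lim_seq_const.
  intros n. split; [apply Rabs_pos | apply H].
Qed.

Lemma Cseries_telescope (b : nat -> C) :
  is_lim_seq (fun n => Cmod (b n)) 0 ->
  Cseries (fun n => (b (S n) - b n)%C) (- b 0%nat)%C.
Proof.
  intros Hb. apply Cseries_components. split.
  - apply (is_series_telescope (fun n => Re (b n))).
    apply is_lim_seq_dominated with (2 := Hb). intros n. apply re_le_Cmod.
  - apply (is_series_telescope (fun n => Im (b n))).
    apply is_lim_seq_dominated with (2 := Hb). intros n. apply im_le_Cmod.
Qed.

Lemma hurwitz_continuation_series (a : R) (s : C) :
  1 <= a -> 1 < Re s ->
  Cseries (fun n => Rcpow (a + INR n) (- s)) (hurwitz_continuation a s).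
Proof.
  intros Ha Hs.
  assert (Hs1 : (s - 1)%C <> 0%C).
  { intros E. apply (f_equal Re) in E. destruct s; simpl in *. lra. }
  assert (HG := hurwitz_term_series a s Ha ltac:(lra)).
  assert (HT : Cseries (fun n => (Rcpow (a + INR (S n)) (1 - s) - Rcpow (a + INR n) (1 - s))%C)
                 (- Rcpow (a + INR 0) (1 - s))%C).
  { apply (Cseries_telescope (fun n => Rcpow (a + INR n) (1 - s))).
    apply (is_lim_seq_ext (fun n => Rpower (a + INR n) (- (Re s - 1)))).
    - intros n. rewrite Cmod_Rcpow. f_equal. destruct s; simpl. ring.
    - apply is_lim_seq_Rpower_opp; lra. }
  (* Removing the telescoping differences from [hurwitz_term] and dividing by s - 1 leaves x^(-s)
     term by term. *)
  assert (X := Cseries_scal (/ (s - 1)) _ _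
    (Cseries_plus _ _ _ _ HG (Cseries_scal (- (1)) _ _ HT))).
  unfold hurwitz_continuation.
  match type of X with is_series _ ?l =>
    match goal with |- is_series _ ?l' => replace l' with l end end.
  - revert X. apply Cseries_ext. intros n. unfold hurwitz_term.
    rewrite S_INR, <- Rplus_assoc. field. exact Hs1.
  - change (INR 0) with 0. rewrite Rplus_0_r. field. exact Hs1.
Qed.

Lemma hurwitz_continuation_correct (a : R) :
  1 <= a -> is_hurwitz_zeta a (hurwitz_continuation a).
Proof.
  intros Ha. split.
  - intros s Hs. now apply hurwitz_continuation_series.
  - intros s Hs Hs1. now apply hurwitz_continuation_analytic.
Qed.

(** By telescoping, a^(1-alpha) plus the first N terms of the series is (alpha-1) times
    [hurwitz_approx alpha a N]; this holds on both sides of 1. *)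
Lemma hurwitz_continuation_real (alpha a : R) :
  1 <= a -> 0 < alpha -> alpha <> 1 ->
  is_lim_seq (hurwitz_approx alpha a) (Re (hurwitz_continuation a (RtoC alpha))).
Proof.
  intros Ha Hal Hal1.
  set (t := fun n => (alpha - 1) * Rpower (a + INR n) (- alpha)
     - Rpower (a + INR n) (1 - alpha) + Rpower (a + INR n + 1) (1 - alpha)).
  assert (Ht : forall n, hurwitz_term (a + INR n) (RtoC alpha) = RtoC (t n)).
  { intros n. unfold hurwitz_term, t.
    rewrite <- RtoC_opp, <- !RtoC_minus, !Rcpow_RtoC.
    now rewrite RtoC_plus, !RtoC_minus, RtoC_mult, !RtoC_minus. }
  assert (HG := hurwitz_term_series a (RtoC alpha) Ha Hal).
  set (G := Csum (fun n => hurwitz_term (a + INR n) (RtoC alpha))) in *.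
  apply Cseries_components in HG. destruct HG as [HG _].
  apply (is_series_ext_R _ t) in HG; [|intros n; now rewrite Ht].
  apply is_series_psum in HG.
  replace (Re (hurwitz_continuation a (RtoC alpha)))
    with (/ (alpha - 1) * (Re G + Rpower a (1 - alpha))).
  - apply (is_lim_seq_ext (fun N => / (alpha - 1) * (psum t N + Rpower a (1 - alpha)))).
    + intros N. unfold hurwitz_approx.
      enough (E : psum t N + Rpower a (1 - alpha) =
        (alpha - 1) * psum (fun n => Rpower (a + INR n) (- alpha)) N
        + Rpower (a + INR N) (1 - alpha)) by (rewrite E; field; lra).
      induction N as [|N IH].
      * simpl. rewrite Rplus_0_r. ring.
      * transitivity (psum t N + Rpower a (1 - alpha) + t N); [simpl; ring|].
        rewrite IH, S_INR, <- Rplus_assoc. simpl psum. unfold t. ring.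
    + apply (is_lim_seq_scal_l _ (/ (alpha - 1)) (Re G + Rpower a (1 - alpha))).
      apply is_lim_seq_plus'; [exact HG | apply is_lim_seq_const].
  - unfold hurwitz_continuation. fold G.
    rewrite <- !RtoC_minus, Rcpow_RtoC. unfold Cdiv.
    rewrite <- RtoC_inv by lra. destruct G as [g1 g2]. simpl. ring.
Qed.

(** * Uniqueness of the continuation *)

Lemma ex_pseries_CV_radius (p : nat -> R) (x : R) :
  ex_pseries p x -> Rbar_le (Rabs x) (CV_radius p).
Proof.
  intros H. apply Rbar_not_lt_le. intros Hlt.
  apply (CV_disk_outside p x Hlt), ex_series_lim_0, ex_pseries_R, H.
Qed.

(** Continuity at 0 kills the constant coefficient, and dividing by x shifts the series for the
    induction. Zeros are assumed on the left only because a supremum of zero intervals provides no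
    others. *)
Lemma PSeries_zero_left (p : nat -> R) (d : R) (k : nat) :
  0 < d -> Rbar_lt 0 (CV_radius p) ->
  (forall x, - d < x < 0 -> ex_pseries p x /\ PSeries p x = 0) -> p k = 0.
Proof.
  intros Hd. revert p. induction k as [|k IH]; intros p Hp Hz.
  all: assert (H0 : p 0%nat = 0).
  1,3: destruct (Req_dec (p 0%nat) 0) as [E|E]; [exact E|exfalso];
    destruct (PSeries_continuity p 0) with (eps := Rabs (p 0%nat)) as [e [He Hc]];
    [rewrite Rabs_R0; exact Hp | now apply Rabs_pos_lt |];
    set (x := - Rmin (d / 2) (e / 2));
    assert (Hx : - d < x < 0 /\ - e < x) by
      (unfold x; pose proof (Rmin_l (d / 2) (e / 2)); pose proof (Rmin_r (d / 2) (e / 2));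
       assert (0 < Rmin (d / 2) (e / 2)) by (apply Rmin_glb_lt; lra); lra);
    specialize (Hc x); simpl in Hc; unfold R_dist in Hc;
    rewrite (proj2 (Hz x (proj1 Hx))), PSeries_0, Rminus_0_l, Rabs_Ropp in Hc;
    apply (Rlt_irrefl (Rabs (p 0%nat))), Hc; split;
    [split; [exact I | lra] | rewrite Rminus_0_r, Rabs_left; lra].
  - exact H0.
  - apply (IH (PS_decr_1 p)).
    + now rewrite CV_radius_decr_1.
    + intros x Hx. destruct (Hz x Hx) as [Hex Hzx]. split.
      * destruct Hex as [l Hl].
        eexists. apply (is_pseries_decr_1 p x (/ x) l); [|exact Hl].
        unfold mult, one; simpl. field. lra.
      * rewrite (PSeries_decr_1 p x Hex), H0 in Hzx.
        apply Rmult_eq_reg_l with x; lra.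
Qed.

Definition real_analytic_at (h : R -> R) (T : R) : Prop :=
  exists (p : nat -> R) (e : R), 0 < e /\
    forall x, Rabs x < e -> is_series (fun k => p k * x ^ k) (h (T + x)).

Lemma real_analytic_zero_left (h : R -> R) (T d : R) :
  real_analytic_at h T -> 0 < d -> (forall x, - d < x < 0 -> h (T + x) = 0) ->
  exists e, 0 < e /\ forall x, Rabs x < e -> h (T + x) = 0.
Proof.
  intros [p [e [He Hp]]] Hd Hz. exists e. split; [exact He|].
  assert (Hm : 0 < Rmin d e) by now apply Rmin_glb_lt.
  assert (Hp0 : forall k, p k = 0).
  { intros k. apply (PSeries_zero_left p (Rmin d e)); auto.
    - apply Rbar_lt_le_trans with (Finite (Rabs (e / 2))).
      + simpl. apply Rabs_pos_lt. lra.
      + apply ex_pseries_CV_radius, ex_pseries_R. eexists. apply Hp.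
        rewrite Rabs_pos_eq; lra.
    - intros x Hx. pose proof (Rmin_l d e). pose proof (Rmin_r d e).
      assert (Hs : is_pseries p x (h (T + x))).
      { apply is_pseries_R, Hp. rewrite Rabs_left; lra. }
      split; [eexists; exact Hs|].
      rewrite (is_pseries_unique _ _ _ Hs). apply Hz. lra. }
  intros x Hx. rewrite <- (is_series_unique _ _ (Hp x Hx)).
  rewrite (Series_ext _ (fun k => 0 * p k)).
  - rewrite Series_scal_l. ring.
  - intros k. rewrite Hp0. ring.
Qed.

(** Let T be the supremum of the t such that h vanishes on [0,t]. As T >= d > 0, h vanishes on an
    interval to the left of T, hence around T, which contradicts T < 1. *)
Lemma real_analytic_zero_interval (h : R -> R) (d : R) :
  0 < d <= 1 -> (forall T, 0 <= T <= 1 -> real_analytic_at h T) ->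
  (forall t, 0 <= t <= d -> h t = 0) -> h 1 = 0.
Proof.
  intros Hd Han Hz.
  set (E := fun t => 0 <= t <= 1 /\ forall u, 0 <= u <= t -> h u = 0).
  destruct (completeness E) as [T [Tub Tlub]].
  { exists 1. intros t [Ht _]. lra. }
  { exists d. split; [lra | exact Hz]. }
  assert (HdT : d <= T) by (apply Tub; split; [lra | exact Hz]).
  assert (HT1 : T <= 1) by (apply Tlub; intros t [Ht _]; lra).
  assert (HzT : forall u, 0 <= u < T -> h u = 0).
  { intros u Hu. destruct (Req_dec (h u) 0) as [E0|E0]; [exact E0|exfalso].
    assert (T <= u); [|lra]. apply Tlub. intros t [Ht Htz].
    destruct (Rle_dec t u) as [L|L]; [exact L|]. exfalso. apply E0, Htz. lra. }
  destruct (real_analytic_zero_left h T T) as [e [He Hze]].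
  - apply Han. lra.
  - lra.
  - intros x Hx. apply HzT. lra.
  - destruct (Req_dec T 1) as [E1|E1].
    + rewrite <- E1, <- (Rplus_0_r T). apply Hze. now rewrite Rabs_R0.
    + exfalso. set (t := Rmin (T + e / 2) 1).
      assert (Ht : T < t /\ t <= T + e / 2 /\ t <= 1).
      { unfold t. split; [apply Rmin_glb_lt; lra|]. split; [apply Rmin_l | apply Rmin_r]. }
      assert (t <= T); [|lra]. apply Tub. split; [lra|].
      intros u Hu. destruct (Rlt_dec u T) as [L|L]; [apply HzT; lra|].
      replace u with (T + (u - T)) by ring. apply Hze. rewrite Rabs_pos_eq; lra.
Qed.

(** With s - s0 = x v the factor v^k goes into the coefficients and x^k stays real, so that real and
    imaginary parts can be taken coefficientwise. *)
Lemma analytic_diff_line (f g : C -> C) (s0 v : C) :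
  v <> 0%C -> analytic_at f s0 -> analytic_at g s0 ->
  exists (c : nat -> C) (e : R), 0 < e /\ forall x : R, Rabs x < e ->
    Cseries (fun k => (c k * RtoC (x ^ k))%C) (f (s0 + RtoC x * v) - g (s0 + RtoC x * v))%C.
Proof.
  intros Hv [c [r [Hr Hc]]] [d [r' [Hr' Hd]]].
  apply Cmod_gt_0 in Hv.
  exists (fun k => (c k - d k) * v ^ k)%C, (Rmin r r' / Cmod v).
  split; [apply Rdiv_lt_0_compat; [now apply Rmin_glb_lt | exact Hv]|].
  intros x Hx.
  assert (Hn : Cmod (s0 + RtoC x * v - s0) < Rmin r r').
  { replace (s0 + RtoC x * v - s0)%C with (RtoC x * v)%C by ring.
    rewrite Cmod_mult, Cmod_R. apply (Rmult_lt_compat_r (Cmod v)) in Hx; [|exact Hv].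
    replace (Rmin r r' / Cmod v * Cmod v) with (Rmin r r') in Hx by (field; lra).
    exact Hx. }
  assert (X1 := Hc _ (Rlt_le_trans _ _ _ Hn (Rmin_l r r'))).
  assert (X2 := Hd _ (Rlt_le_trans _ _ _ Hn (Rmin_r r r'))).
  assert (X := Cseries_plus _ _ _ _ X1 (Cseries_scal (- (1)) _ _ X2)).
  replace (f (s0 + RtoC x * v) - g (s0 + RtoC x * v))%C with
    (f (s0 + RtoC x * v) + - (1) * g (s0 + RtoC x * v))%C by ring.
  revert X. apply Cseries_ext. intros k.
  replace (s0 + RtoC x * v - s0)%C with (RtoC x * v)%C by ring.
  rewrite Cpow_mult_l, RtoC_pow. ring.
Qed.

Lemma hurwitz_zeta_unique (a alpha : R) (f g : C -> C) :
  0 < alpha -> alpha <> 1 -> is_hurwitz_zeta a f -> is_hurwitz_zeta a g ->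
  f (RtoC alpha) = g (RtoC alpha).
Proof.
  intros Hal Hal1 [Hf1 Hf2] [Hg1 Hg2].
  set (v := (alpha - 2, -1) : C).
  (* the segment from 2 + i to alpha avoids the pole 1 *)
  set (gam := fun t : R => ((2, 1) + RtoC t * v)%C).
  assert (Hgam : forall t, gam t = (2 + t * (alpha - 2), 1 - t)).
  { intros t. unfold gam, v, RtoC, Cplus, Cmult; simpl. f_equal; ring. }
  assert (Hshift : forall T x, gam (T + x) = (gam T + RtoC x * v)%C).
  { intros T x. unfold gam. rewrite RtoC_plus. ring. }
  assert (Hv : v <> 0%C).
  { intros E. apply (f_equal Im) in E. unfold v in E. simpl in E. lra. }
  assert (Hline : forall T, 0 <= T <= 1 ->
    exists (c : nat -> C) (e : R), 0 < e /\ forall x : R, Rabs x < e ->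
      Cseries (fun k => (c k * RtoC (x ^ k))%C) (f (gam (T + x)%R) - g (gam (T + x)%R))%C).
  { intros T HT.
    assert (HRe : 0 < Re (gam T)) by (rewrite Hgam; simpl; nra).
    (* The imaginary part 1 - T vanishes only at T = 1, where the point is alpha. *)
    assert (Hne : gam T <> RtoC 1).
    { intros E. rewrite Hgam in E.
      pose proof (f_equal Re E) as E1. pose proof (f_equal Im E) as E2. simpl in E1, E2.
      apply Hal1. replace T with 1 in E1 by lra. lra. }
    destruct (analytic_diff_line f g (gam T) v) as [c [e [He Hc]]]; auto.
    exists c, e. split; [exact He|]. intros x Hx. rewrite Hshift. now apply Hc. }
  (* For t <= 1/4 and alpha > 0 the real part is at least 2 - 2t >= 3/2, inside the half-plane where
     both functions are the sum of the series. *)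
  assert (Hstart : forall t, 0 <= t <= / 4 -> (f (gam t) - g (gam t))%C = RtoC 0).
  { intros t Ht. assert (HRe : 1 < Re (gam t)) by (rewrite Hgam; simpl; nra).
    rewrite (Cseries_unique _ _ _ (Hf1 _ HRe) (Hg1 _ HRe)). ring. }
  assert (Hend : gam 1 = RtoC alpha).
  { rewrite Hgam. unfold RtoC. f_equal; ring. }
  assert (HR : Re (f (gam 1) - g (gam 1))%C = 0).
  { apply (real_analytic_zero_interval (fun t => Re (f (gam t) - g (gam t))%C) (/ 4)).
    - lra.
    - intros T HT. destruct (Hline T HT) as [c [e [He Hc]]].
      exists (fun k => Re (c k)), e. split; [exact He|]. intros x Hx.
      assert (X := proj1 (proj1 (Cseries_components _ _) (Hc x Hx))).
      revert X. apply is_series_ext_R. intros k. destruct (c k). simpl. ring.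
    - intros t Ht. now rewrite Hstart. }
  assert (HI : Im (f (gam 1) - g (gam 1))%C = 0).
  { apply (real_analytic_zero_interval (fun t => Im (f (gam t) - g (gam t))%C) (/ 4)).
    - lra.
    - intros T HT. destruct (Hline T HT) as [c [e [He Hc]]].
      exists (fun k => Im (c k)), e. split; [exact He|]. intros x Hx.
      assert (X := proj2 (proj1 (Cseries_components _ _) (Hc x Hx))).
      revert X. apply is_series_ext_R. intros k. destruct (c k). simpl. ring.
    - intros t Ht. now rewrite Hstart. }
  rewrite <- Hend. transitivity (f (gam 1) - g (gam 1) + g (gam 1))%C; [ring|].
  replace (f (gam 1) - g (gam 1))%C with (RtoC 0); [ring|].
  destruct (f (gam 1) - g (gam 1))%C. simpl in HR, HI. now rewrite HR, HI.
Qed.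

(** The explicit continuation makes [epsilon_spec] applicable, and uniqueness identifies the chosen
    function with it at alpha. All later facts on [hurwitz_zeta] come from this limit. *)
Lemma hurwitz_zeta_limit (alpha a : R) :
  1 <= a -> 0 < alpha -> alpha <> 1 ->
  is_lim_seq (hurwitz_approx alpha a) (hurwitz_zeta alpha a).
Proof.
  intros Ha Hal Hal1.
  unfold hurwitz_zeta.
  rewrite (hurwitz_zeta_unique a alpha _ (hurwitz_continuation a)); auto.
  - now apply hurwitz_continuation_real.
  - unfold hurwitz_zeta_C. apply epsilon_spec. eexists. now apply hurwitz_continuation_correct.
  - now apply hurwitz_continuation_correct.
Qed.

(** * Digit sums and Abel summation *)

Lemma psum_succ (f : nat -> R) (N : nat) : psum f (S N) = psum f N + f N.
Proof. reflexivity. Qed.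

Lemma psum_ext (f g : nat -> R) (N : nat) :
  (forall n, (n < N)%nat -> f n = g n) -> psum f N = psum g N.
Proof.
  induction N as [|N IH]; intros H; simpl; [reflexivity|].
  rewrite IH, H; auto.
Qed.

Lemma psum_lin_comb (x y : R) (f g : nat -> R) (N : nat) :
  psum (fun n => x * f n + y * g n) N = x * psum f N + y * psum g N.
Proof. induction N as [|N IH]; simpl; [|rewrite IH]; ring. Qed.

Lemma psum_scal_l (x : R) (f : nat -> R) (N : nat) :
  psum (fun n => x * f n) N = x * psum f N.
Proof. induction N as [|N IH]; simpl; [|rewrite IH]; ring. Qed.

Lemma psum_scal_r (x : R) (f : nat -> R) (N : nat) :
  psum (fun n => f n * x) N = psum f N * x.
Proof. induction N as [|N IH]; simpl; [|rewrite IH]; ring. Qed.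

Lemma psum_plus (f g : nat -> R) (N : nat) :
  psum (fun n => f n + g n) N = psum f N + psum g N.
Proof. induction N as [|N IH]; simpl; [|rewrite IH]; ring. Qed.

Lemma psum_switch (f : nat -> nat -> R) (N M : nat) :
  psum (fun n => psum (fun m => f n m) M) N = psum (fun m => psum (fun n => f n m) N) M.
Proof.
  induction N as [|N IH]; simpl.
  - induction M as [|M IH]; simpl; [|rewrite <- IH]; ring.
  - rewrite IH. now rewrite <- psum_plus.
Qed.

Lemma psum_bounds (f : nat -> R) (M : R) (N : nat) :
  (forall n, (n < N)%nat -> 0 <= f n <= M) -> 0 <= psum f N <= INR N * M.
Proof.
  induction N as [|N IH]; intros H.
  - simpl. lra.
  - rewrite S_INR. simpl psum. pose proof (H N ltac:(lia)).
    destruct IH; [intros; apply H; lia|]. lra.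
Qed.

Lemma is_series_drop_zero (f : nat -> R) (l : R) :
  f 0%nat = 0 -> is_lim_seq (psum f) l -> is_series (fun k => f (S k)) l.
Proof.
  intros H0 Hl. apply is_series_psum. apply is_lim_seq_incr_1 in Hl.
  revert Hl. apply is_lim_seq_ext. intros N.
  induction N as [|N IH]; simpl in *; [rewrite H0; ring | rewrite IH; reflexivity].
Qed.

Lemma INR_list_sum_seq (f : nat -> nat) (K : nat) :
  INR (list_sum (map f (seq 0 K))) = psum (fun i => INR (f i)) K.
Proof.
  induction K as [|K IH]; [reflexivity|].
  rewrite seq_S, map_app, list_sum_app, plus_INR, IH. simpl.
  now rewrite Nat.add_0_r.
Qed.

(** The i-th digit is floor(n/b^i) - b floor(n/b^(i+1)); summing leaves n, minus b - 1 times the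
    inner floors, minus a last floor that vanishes once n < b^K. *)
Lemma psum_digits (b n K : nat) : (2 <= b)%nat ->
  psum (fun i => INR ((n / b ^ i) mod b)) K =
  INR n - (INR b - 1) * psum (fun i => INR (n / b ^ S i)) K - INR (n / b ^ K).
Proof.
  intros hb. induction K as [|K IH].
  - rewrite Nat.pow_0_r, Nat.div_1_r. simpl. ring.
  - rewrite !psum_succ, IH.
    assert (E : (n / b ^ S K)%nat = (n / b ^ K / b)%nat).
    { rewrite Nat.Div0.div_div. f_equal. simpl. lia. }
    assert (D := f_equal INR (Nat.div_mod_eq (n / b ^ K) b)).
    rewrite plus_INR, mult_INR in D. rewrite E, D. ring.
Qed.

Lemma psum_digits_stable (b n K j : nat) : (2 <= b)%nat -> (n < b ^ K)%nat ->
  psum (fun i => INR ((n / b ^ i) mod b)) (K + j) =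
  psum (fun i => INR ((n / b ^ i) mod b)) K.
Proof.
  intros hb Hn. induction j as [|j IH].
  - now rewrite Nat.add_0_r.
  - rewrite Nat.add_succ_r, psum_succ, IH, Nat.div_small.
    + rewrite Nat.Div0.mod_0_l. simpl INR. ring.
    + eapply Nat.lt_le_trans; [exact Hn|]. apply Nat.pow_le_mono_r; lia.
Qed.

Lemma digit_sum_legendre (b n L : nat) : (2 <= b)%nat -> (n < b ^ L)%nat ->
  INR (digit_sum b n) = INR n - (INR b - 1) * psum (fun i => INR (n / b ^ S i)) L.
Proof.
  intros hb Hn. unfold digit_sum. rewrite INR_list_sum_seq.
  assert (Hn' : (n < b ^ S n)%nat).
  { apply Nat.lt_trans with (S n); [lia | apply Nat.pow_gt_lin_r; lia]. }
  (* Lengths [S n] and [L] are compared through their sum: the digits beyond either length are 0. *)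
  rewrite <- (psum_digits_stable b n (S n) L), Nat.add_comm, psum_digits_stable by assumption.
  rewrite psum_digits, (Nat.div_small n (b ^ L)) by assumption. simpl INR. ring.
Qed.

Lemma psum_add (f : nat -> R) (N K : nat) :
  psum f (N + K) = psum f N + psum (fun k => f (N + k)%nat) K.
Proof.
  induction K as [|K IH].
  - rewrite Nat.add_0_r. simpl. ring.
  - rewrite Nat.add_succ_r. simpl. rewrite IH. ring.
Qed.

Lemma psum_telescope (u : nat -> R) (N K : nat) :
  psum (fun k => u (N + k)%nat - u (S (N + k))) K = u N - u (N + K)%nat.
Proof.
  induction K as [|K IH].
  - rewrite Nat.add_0_r. simpl. ring.
  - rewrite Nat.add_succ_r. simpl. rewrite IH. ring.
Qed.

(** floor(n/d) is constant on each of the M blocks of length d, and each block telescopes. *)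
Lemma psum_floor_abel (u : nat -> R) (d M : nat) : (1 <= d)%nat ->
  psum (fun n => INR (n / d) * (u n - u (S n))) (d * M) =
  psum (fun m => u (d * S m)%nat) M - INR M * u (d * M)%nat.
Proof.
  intros hd. induction M as [|M IH].
  - rewrite Nat.mul_0_r. simpl. ring.
  - rewrite Nat.mul_succ_r at 1. rewrite psum_add, IH.
    rewrite (psum_ext (fun k => INR ((d * M + k) / d) * _)
      (fun k => INR M * (u (d * M + k)%nat - u (S (d * M + k))))).
    + rewrite psum_scal_l, psum_telescope.
      rewrite <- Nat.mul_succ_r, S_INR, psum_succ. ring.
    + intros k Hk. do 2 f_equal.
      rewrite Nat.mul_comm, Nat.div_add_l, Nat.div_small; lia.
Qed.

(** [W l] is the contribution of the weight floor(n/b^l). Stopping at n < b^L makes the blocks of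
    length b^l complete for every l <= L. *)
Lemma psum_digit_sum (b L : nat) (u : nat -> R) : (2 <= b)%nat ->
  let W l := psum (fun m => u (b ^ l * S m)%nat) (b ^ (L - l))
             - INR (b ^ (L - l)) * u (b ^ L)%nat in
  psum (fun n => INR (digit_sum b n) * (u n - u (S n))) (b ^ L) =
  W 0%nat - (INR b - 1) * psum (fun l => W (S l)) L.
Proof.
  intros hb W.
  assert (HW : forall l, (l <= L)%nat ->
    psum (fun n => INR (n / b ^ l) * (u n - u (S n))) (b ^ L) = W l).
  { intros l Hl. unfold W.
    assert (E : (b ^ L = b ^ l * b ^ (L - l))%nat).
    { rewrite <- Nat.pow_add_r. f_equal. lia. }
    rewrite E. apply psum_floor_abel.
    pose proof (Nat.pow_nonzero b l). lia. }
  (* The linear term n of the digit formula is written as n / b^0, so that it becomes [W 0]. *)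
  rewrite (psum_ext _ (fun n => 1 * (INR (n / b ^ 0) * (u n - u (S n)))
    + (- (INR b - 1)) * psum (fun l => INR (n / b ^ S l) * (u n - u (S n))) L)).
  - rewrite psum_lin_comb, psum_switch, HW by lia.
    rewrite (psum_ext (fun l => psum _ (b ^ L)) (fun l => W (S l))) by (intros; apply HW; lia).
    ring.
  - intros n Hn. rewrite (digit_sum_legendre b n L hb Hn), psum_scal_r.
    rewrite Nat.pow_0_r, Nat.div_1_r. ring.
Qed.

Lemma psum_geom (B : R) (L : nat) : B <> 0 ->
  (B - 1) * psum (fun l => / B ^ S l) L = 1 - / B ^ L.
Proof.
  intros HB. induction L as [|L IH].
  - simpl. field.
  - rewrite psum_succ, Rmult_plus_distr_l, IH. simpl. field.
    split; [now apply pow_nonzero | exact HB].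
Qed.

(** * Scaled blocks of the Hurwitz series, and auxiliary limits *)

Lemma Rpower_scale_pos (B Z p : R) (l : nat) : 0 < B -> 0 < Z ->
  Rpower (B ^ l) p * Rpower (Z / B ^ l) p = Rpower Z p.
Proof.
  intros HB HZ. assert (0 < B ^ l) by now apply pow_lt.
  rewrite Rpower_mult_distr; [|assumption | now apply Rdiv_lt_0_compat].
  f_equal. field. lra.
Qed.

Lemma Rpower_pow_opp (B p : R) (l : nat) : 0 < B ->
  Rpower (B ^ l) (- p) = Rpower B (- p) ^ l.
Proof.
  intros HB. rewrite <- Rpower_pow, <- Rpower_pow by (auto using Rpower_pos).
  rewrite !Rpower_mult. f_equal. ring.
Qed.

(** As z + B^l (m+1) = B^l (a+m), the sum is (B^l)^(-alpha) times a partial Hurwitz sum at a. The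
    limit bounds are used at index K although the sum has K + 1 terms: then the endpoint a + K is Z
    / B^l, and the extra term, equal to Z^(-alpha) after scaling, is the width of the bounds. *)
Lemma hurwitz_block_error (alpha z B : R) (l K : nat) :
  0 < alpha -> alpha <> 1 -> 0 <= z -> 1 <= B ->
  let a := 1 + z / B ^ l in
  let Z := z + B ^ l * INR (S K) in
  0 <= psum (fun m => Rpower (z + B ^ l * INR (S m)) (- alpha)) (S K)
       - Rpower (B ^ l) (- alpha) * hurwitz_zeta alpha a
       + / B ^ l * (Rpower Z (1 - alpha) / (alpha - 1))
    <= Rpower Z (- alpha).
Proof.
  intros Hal Hal1 Hz HB a Z.
  assert (HBl : 0 < B ^ l) by (apply pow_lt; lra).
  assert (Ha : 1 <= a).
  { unfold a. assert (0 <= z / B ^ l) by now apply Rle_mult_inv_pos. lra. }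
  assert (HQ : Z / B ^ l = a + INR K).
  { unfold Z, a. rewrite S_INR. field. lra. }
  assert (HaK : 0 < a + INR K) by (pose proof (pos_INR K); lra).
  assert (HZ : 0 < Z).
  { replace Z with (Z / B ^ l * B ^ l) by (field; lra). rewrite HQ. now apply Rmult_lt_0_compat. }
  pose proof (hurwitz_approx_limit_bounds alpha a _ K ltac:(lra) Hal Hal1
                (hurwitz_zeta_limit alpha a Ha Hal Hal1)) as H.
  unfold hurwitz_approx in H. set (H0 := hurwitz_zeta alpha a) in *.
  set (c := Rpower (B ^ l) (- alpha)).
  assert (Hc : 0 < c) by apply Rpower_pos.
  assert (E1 : psum (fun m => Rpower (z + B ^ l * INR (S m)) (- alpha)) (S K)
     = c * (psum (fun n => Rpower (a + INR n) (- alpha)) K + Rpower (a + INR K) (- alpha))).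
  { change (psum (fun n => Rpower (a + INR n) (- alpha)) K + Rpower (a + INR K) (- alpha))
      with (psum (fun n => Rpower (a + INR n) (- alpha)) (S K)).
    rewrite <- psum_scal_l. apply psum_ext. intros m _. unfold c.
    assert (Hm : 0 < z + B ^ l * INR (S m)).
    { pose proof (pos_INR m). rewrite S_INR. nra. }
    rewrite <- (Rpower_scale_pos B _ (- alpha) l) by lra.
    do 2 f_equal. unfold a. rewrite S_INR. field. lra. }
  assert (E2 : c * Rpower (a + INR K) (- alpha) = Rpower Z (- alpha)).
  { unfold c. rewrite <- HQ. apply Rpower_scale_pos; lra. }
  assert (E3 : / B ^ l * Rpower Z (1 - alpha) = c * Rpower (a + INR K) (1 - alpha)).
  { unfold Rminus. rewrite !Rpower_plus, !Rpower_1 by assumption.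
    rewrite <- E2, <- HQ. field. lra. }
  rewrite E1.
  replace (/ B ^ l * (Rpower Z (1 - alpha) / (alpha - 1)))
    with (c * Rpower (a + INR K) (1 - alpha) * / (alpha - 1)) by (rewrite <- E3; field; lra).
  rewrite <- E2.
  replace (c * (psum (fun n => Rpower (a + INR n) (- alpha)) K + Rpower (a + INR K) (- alpha))
     - c * H0 + c * Rpower (a + INR K) (1 - alpha) * / (alpha - 1))
   with (c * (psum (fun n => Rpower (a + INR n) (- alpha)) K
      + Rpower (a + INR K) (1 - alpha) / (alpha - 1) + Rpower (a + INR K) (- alpha) - H0))
   by (field; lra).
  split; [apply Rmult_le_pos; lra | apply Rmult_le_compat_l; lra].
Qed.

(** The limit bounds at N = 0, where the sum is empty; a >= 1 gives a^(1-alpha) <= a and a^(-alpha)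
    <= 1. *)
Lemma hurwitz_zeta_bound (alpha a : R) :
  1 <= a -> 0 < alpha -> alpha <> 1 ->
  Rabs (hurwitz_zeta alpha a) <= a / Rabs (alpha - 1) + 1.
Proof.
  intros Ha Hal Hal1.
  pose proof (hurwitz_approx_limit_bounds alpha a _ 0 ltac:(lra) Hal Hal1
                (hurwitz_zeta_limit alpha a Ha Hal Hal1)) as H.
  unfold hurwitz_approx in H. simpl in H. rewrite Rplus_0_r, Rplus_0_l in H.
  assert (P1 : Rpower a (- alpha) <= 1).
  { rewrite <- (Rpower_O a) by lra. apply Rle_Rpower; lra. }
  assert (P2 : Rpower a (1 - alpha) <= a).
  { rewrite <- (Rpower_1 a) at 2 by lra. apply Rle_Rpower; lra. }
  pose proof (Rpower_pos a (- alpha)). pose proof (Rpower_pos a (1 - alpha)).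
  assert (HA : 0 < Rabs (alpha - 1)) by (apply Rabs_pos_lt; lra).
  replace (hurwitz_zeta alpha a) with (Rpower a (1 - alpha) / (alpha - 1)
    + (hurwitz_zeta alpha a - Rpower a (1 - alpha) / (alpha - 1))) by ring.
  eapply Rle_trans; [apply Rabs_triang|]. apply Rplus_le_compat.
  - unfold Rdiv. rewrite Rabs_mult, Rabs_inv, (Rabs_pos_eq (Rpower _ _)) by lra.
    apply Rmult_le_compat_r; [apply Rlt_le, Rinv_0_lt_compat, HA | exact P2].
  - rewrite Rabs_pos_eq; lra.
Qed.

(** Write q = r^2 with r = exp(-t). From 1 + t n <= exp(t n) one gets n r^n <= 1/t, and the other
    factor r^n tends to 0. *)
Lemma is_lim_seq_INR_geom (q : R) : 0 < q < 1 -> is_lim_seq (fun n => INR n * q ^ n) 0.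
Proof.
  intros Hq. set (t := - ln q / 2).
  assert (Ht : 0 < t).
  { unfold t. assert (ln q < ln 1) by (apply ln_increasing; lra). rewrite ln_1 in H. lra. }
  assert (Eq : q = exp (- t) * exp (- t)).
  { rewrite <- exp_plus. unfold t. replace (- (- ln q / 2) + - (- ln q / 2)) with (ln q) by field.
    now rewrite exp_ln by lra. }
  assert (Hr : 0 < exp (- t) < 1).
  { split; [apply exp_pos|]. rewrite <- exp_0. apply exp_increasing. lra. }
  set (r := exp (- t)) in *.
  apply is_lim_seq_dominated with (fun n => / t * r ^ n).
  - intros n. rewrite Rabs_pos_eq by (apply Rmult_le_pos; [apply pos_INR | apply pow_le; lra]).
    rewrite Eq, Rpow_mult_distr, <- Rmult_assoc.
    apply Rmult_le_compat_r; [apply pow_le; lra|].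
    apply Rmult_le_reg_l with t; [exact Ht|]. rewrite Rinv_r by lra.
    unfold r. rewrite <- Rpower_pow by apply exp_pos.
    unfold Rpower. rewrite ln_exp.
    replace (INR n * - t) with (- (t * INR n)) by ring. rewrite exp_Ropp.
    pose proof (exp_pos (t * INR n)). pose proof (exp_ineq1_le (t * INR n)).
    apply Rmult_le_reg_r with (exp (t * INR n)); [assumption|].
    field_simplify; lra.
  - replace (Finite 0) with (Rbar_mult (/ t) 0) by (simpl; f_equal; ring).
    apply is_lim_seq_scal_l, is_lim_seq_geom. rewrite Rabs_pos_eq; lra.
Qed.

(** Since n <= phi n, the limit l of the increasing subsequence bounds v, so v converges,
    necessarily to l. *)
Lemma is_lim_seq_monotone_subseq (v : nat -> R) (phi : nat -> nat) (l : R) :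
  (forall n, v n <= v (S n)) -> (forall n, (phi n < phi (S n))%nat) ->
  is_lim_seq (fun n => v (phi n)) l -> is_lim_seq v l.
Proof.
  intros Hv Hphi Hl.
  assert (Hmono : forall n m, (n <= m)%nat -> v n <= v m).
  { intros n m H. induction H; [lra | eapply Rle_trans; [exact IHle | apply Hv]]. }
  assert (Hge : forall n, (n <= phi n)%nat).
  { intros n. induction n as [|n IH]; [lia|]. specialize (Hphi n). lia. }
  destruct (ex_finite_lim_seq_incr v l) as [l' Hl'].
  - exact Hv.
  - intros n. apply Rle_trans with (v (phi n)); [apply Hmono, Hge|].
    apply (is_lim_seq_incr_compare (fun n => v (phi n)) l Hl).
    intros k. apply Hmono. specialize (Hphi k). lia.
  - assert (X := is_lim_seq_subseq v l' phi (eventually_subseq _ Hphi) Hl').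
    apply is_lim_seq_unique in X. apply is_lim_seq_unique in Hl.
    rewrite Hl in X. injection X as ->. exact Hl'.
Qed.

(** * The main estimate *)

(** In the constant, one unit bounds [e 0], another together with (1+z)/|alpha-1| bounds the
    surviving V / B^L, and (b-1) L bounds the errors of the L other levels. *)
Lemma psum_digit_sum_error (b L : nat) (alpha z : R) :
  (2 <= b)%nat -> 0 < alpha -> alpha <> 1 -> 0 <= z ->
  let u n := Rpower (z + INR n) (- alpha) in
  let h l := Rpower (INR b) (- alpha) ^ l * hurwitz_zeta alpha (1 + z / INR b ^ l) in
  Rabs (psum (fun n => INR (digit_sum b n) * (u n - u (S n))) (b ^ L)
        - (h 0%nat - (INR b - 1) * psum (fun l => h (S l)) L))
  <= (2 + (1 + z) / Rabs (alpha - 1) + (INR b - 1) * INR L) * Rpower (INR b) (- alpha) ^ L.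
Proof.
  intros hb Hal Hal1 Hz u h.
  set (B := INR b) in *.
  assert (HB : 2 <= B) by (apply (le_INR 2), hb).
  assert (HBL : forall l, 0 < B ^ l) by (intros; apply pow_lt; lra).
  set (Z := z + B ^ L).
  assert (HZ : B ^ L <= Z) by (unfold Z; lra).
  pose proof (HBL L) as HL.
  set (Zp := Rpower Z (- alpha)).
  (* Two sources, both proportional to 1/B^l: the end term of [hurwitz_block_error], and the Abel
     boundary term b^(L-l) u(b^L) = B^L Zp / B^l. *)
  set (V := Rpower Z (1 - alpha) / (alpha - 1) + B ^ L * Zp).
  assert (HZp : 0 < Zp <= Rpower B (- alpha) ^ L).
  { split; [apply Rpower_pos|]. rewrite <- Rpower_pow_opp by lra.
    apply Rpower_decr; lra. }
  set (W := fun l => psum (fun m => u (b ^ l * S m)%nat) (b ^ (L - l))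
             - INR (b ^ (L - l)) * u (b ^ L)%nat).
  set (e := fun l => W l - h l + / B ^ l * V).
  assert (He : forall l, (l <= L)%nat -> 0 <= e l <= Zp).
  { intros l Hl.
    destruct (b ^ (L - l))%nat as [|K] eqn:EK; [apply Nat.pow_nonzero in EK; lia|].
    assert (EB : B ^ L = B ^ l * INR (S K)).
    { rewrite <- EK, pow_INR. fold B. rewrite <- pow_add. f_equal. lia. }
    pose proof (hurwitz_block_error alpha z B l K Hal Hal1 Hz ltac:(lra)) as H.
    cbv zeta in H. rewrite <- EB in H. fold Z Zp in H.
    enough (E : e l = psum (fun m => Rpower (z + B ^ l * INR (S m)) (- alpha)) (S K)
       - Rpower (B ^ l) (- alpha) * hurwitz_zeta alpha (1 + z / B ^ l)
       + / B ^ l * (Rpower Z (1 - alpha) / (alpha - 1))) by (rewrite E; exact H).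
    unfold e, W, h, V. rewrite EK.
    rewrite (psum_ext (fun m => u (b ^ l * S m)%nat)
       (fun m => Rpower (z + B ^ l * INR (S m)) (- alpha))).
    - assert (Eu : u (b ^ L)%nat = Zp).
      { unfold u, Zp, Z. now rewrite pow_INR. }
      rewrite Eu, Rpower_pow_opp, EB by lra. field. specialize (HBL l). lra.
    - intros m _. unfold u. now rewrite mult_INR, pow_INR. }
  assert (HW : forall l, W l = 1 * e l + 1 * h l + - V * / B ^ l).
  { intros l. unfold e. ring. }
  rewrite (psum_digit_sum b L u hb). fold B.
  change (Rabs (W 0%nat - (B - 1) * psum (fun l => W (S l)) L
     - (h 0%nat - (B - 1) * psum (fun l => h (S l)) L))
   <= (2 + (1 + z) / Rabs (alpha - 1) + (B - 1) * INR L) * Rpower B (- alpha) ^ L).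
  rewrite (psum_ext (fun l => W (S l))
    (fun l => 1 * (1 * e (S l) + 1 * h (S l)) + - V * / B ^ S l)).
  2: { intros l _. rewrite HW. ring. }
  rewrite !psum_lin_comb, HW.
  pose proof (psum_geom B L ltac:(lra)) as HG.
  replace (1 * e 0%nat + 1 * h 0%nat + - V * / B ^ 0 -
    (B - 1) * (1 * (1 * psum (fun n => e (S n)) L + 1 * psum (fun n => h (S n)) L) +
      - V * psum (fun n => / B ^ S n) L) -
    (h 0%nat - (B - 1) * psum (fun l => h (S l)) L))
   with (e 0%nat - (B - 1) * psum (fun n => e (S n)) L
         + V * ((B - 1) * psum (fun n => / B ^ S n) L - 1)) by (simpl pow; field).
  rewrite HG.
  (* What the geometric sum leaves is -V / B^L; as Z^(1-alpha) = Z Zp, it is a bounded multiple of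
     Zp. *)
  replace (V * (1 - / B ^ L - 1)) with (- (Z / B ^ L * / (alpha - 1) + 1) * Zp).
  2: { unfold V, Rminus. rewrite Rpower_plus, Rpower_1 by lra. fold Zp. field. lra. }
  assert (HE := psum_bounds (fun n => e (S n)) Zp L ltac:(intros; apply He; lia)).
  pose proof (He 0%nat ltac:(lia)) as He0.
  assert (HA : 0 < Rabs (alpha - 1)) by (apply Rabs_pos_lt; lra).
  assert (HZB : 0 <= Z / B ^ L <= 1 + z).
  { split; [apply Rle_mult_inv_pos; lra|].
    assert (1 <= B ^ L) by (apply pow_R1_Rle; lra).
    apply Rmult_le_reg_r with (B ^ L); [exact HL|].
    unfold Rdiv. rewrite Rmult_assoc, Rinv_l by lra. unfold Z. nra. }
  apply Rle_trans with ((2 + (1 + z) / Rabs (alpha - 1) + (B - 1) * INR L) * Zp).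
  2: { apply Rmult_le_compat_l; [|apply HZp].
       assert (0 <= (1 + z) / Rabs (alpha - 1)) by (apply Rle_mult_inv_pos; lra).
       assert (0 <= (B - 1) * INR L) by (apply Rmult_le_pos; [lra | apply pos_INR]). lra. }
  assert (HD : Rabs (Z / B ^ L * / (alpha - 1)) <= (1 + z) / Rabs (alpha - 1)).
  { rewrite Rabs_mult, Rabs_inv, (Rabs_pos_eq (Z / B ^ L)) by lra.
    apply Rmult_le_compat_r; [apply Rlt_le, Rinv_0_lt_compat, HA | lra]. }
  set (D := Z / B ^ L * / (alpha - 1)) in *. set (D' := (1 + z) / Rabs (alpha - 1)) in *.
  assert (HDZ : Rabs (D * Zp) <= D' * Zp).
  { rewrite Rabs_mult, (Rabs_pos_eq Zp) by lra. apply Rmult_le_compat_r; lra. }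
  apply Rabs_le_between in HDZ. apply Rabs_le_between.
  set (S0 := psum (fun n => e (S n)) L) in *.
  assert (0 <= (B - 1) * S0 <= (B - 1) * (INR L * Zp)).
  { split; [apply Rmult_le_pos | apply Rmult_le_compat_l]; lra. }
  split; lra.
Qed.

Lemma digit_sum_0 (b : nat) : digit_sum b 0 = 0%nat.
Proof.
  unfold digit_sum. cbn [seq map list_sum].
  now rewrite Nat.Div0.div_0_l, Nat.Div0.mod_0_l.
Qed.

(** All points 1 + z/B^l lie in [1, 1+z], so the zeta values are bounded uniformly in l and a
    geometric series dominates. *)
Lemma ex_series_hurwitz_zeta_geom (alpha z B : R) :
  0 < alpha -> alpha <> 1 -> 0 <= z -> 1 < B ->
  ex_series (fun l => Rpower B (- alpha) ^ S l * hurwitz_zeta alpha (1 + z / B ^ S l)).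
Proof.
  intros Hal Hal1 Hz HB.
  assert (Hrho : 0 < Rpower B (- alpha) < 1).
  { split; [apply Rpower_pos|]. rewrite <- (Rpower_O B) by lra. apply Rpower_lt; lra. }
  set (rho := Rpower B (- alpha)) in *.
  set (K := (1 + z) / Rabs (alpha - 1) + 1).
  apply ex_series_dominated with (fun l => K * rho ^ S l).
  - intros l.
    assert (HBl : 1 <= B ^ S l) by (apply pow_R1_Rle; lra).
    assert (Hzl : 0 <= z / B ^ S l <= z).
    { split; [apply Rle_mult_inv_pos; lra|].
      apply Rmult_le_reg_r with (B ^ S l); [lra|].
      unfold Rdiv. rewrite Rmult_assoc, Rinv_l by lra. nra. }
    pose proof (hurwitz_zeta_bound alpha (1 + z / B ^ S l) ltac:(lra) Hal Hal1) as Hb.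
    rewrite Rabs_mult, (Rabs_pos_eq (rho ^ S l)), Rmult_comm by (apply pow_le; lra).
    apply Rmult_le_compat_r; [apply pow_le; lra|].
    eapply Rle_trans; [exact Hb|]. unfold K. apply Rplus_le_compat_r.
    apply Rmult_le_compat_r; [|lra].
    apply Rlt_le, Rinv_0_lt_compat, Rabs_pos_lt. lra.
  - exists (K * rho * / (1 - rho)).
    apply (is_series_ext_R (fun l => K * rho * rho ^ l)); [intros l; simpl; ring|].
    apply (is_series_scal (V := R_NormedModule) (K * rho) (fun l => rho ^ l)).
    apply is_series_geom. rewrite Rabs_pos_eq; lra.
Qed.

Theorem theorem5 (b : nat) (hb : (2 <= b)%nat) (alpha : R) (halpha : 0 < alpha)
    (halpha1 : alpha <> 1) (z : R) (hz : 0 <= z) :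
  let lhs_term (n : nat) : R :=
    INR (digit_sum b n) *
      (1 / Rpower (z + INR n) alpha - 1 / Rpower (z + INR n + 1) alpha) in
  let rhs_term (l : nat) : R :=
    1 / Rpower (INR b) (INR l * alpha) *
      hurwitz_zeta alpha (1 + z / INR b ^ l) in
  ex_series (fun k => lhs_term (S k)) /\
  ex_series (fun k => rhs_term (S k)) /\
  Series (fun k => lhs_term (S k)) =
    hurwitz_zeta alpha (1 + z) + (1 - INR b) * Series (fun k => rhs_term (S k)).
Proof.
  intros lhs_term rhs_term.
  assert (HB : 2 <= INR b) by (apply (le_INR 2), hb).
  set (u := fun n => Rpower (z + INR n) (- alpha)).
  set (h := fun l => Rpower (INR b) (- alpha) ^ l * hurwitz_zeta alpha (1 + z / INR b ^ l)).
  assert (Hrho : 0 < Rpower (INR b) (- alpha) < 1).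
  { split; [apply Rpower_pos|]. rewrite <- (Rpower_O (INR b)) by lra. apply Rpower_lt; lra. }
  set (rho := Rpower (INR b) (- alpha)) in *.
  assert (Hlhs : forall n, lhs_term n = INR (digit_sum b n) * (u n - u (S n))).
  { intros n. unfold lhs_term, u. rewrite S_INR, !Rpower_Ropp, <- Rplus_assoc.
    unfold Rdiv. now rewrite !Rmult_1_l. }
  assert (Hrhs : forall l, rhs_term l = h l).
  { intros l. unfold rhs_term, h, rho. f_equal.
    rewrite <- Rpower_pow, Rpower_mult by apply Rpower_pos.
    replace (- alpha * INR l) with (- (INR l * alpha)) by ring.
    rewrite Rpower_Ropp. unfold Rdiv. ring. }
  assert (exh : ex_series (fun l => h (S l))).
  { apply ex_series_hurwitz_zeta_geom; lra. }
  assert (Hh0 : h 0%nat = hurwitz_zeta alpha (1 + z)).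
  { unfold h. simpl. unfold Rdiv. now rewrite Rinv_1, Rmult_1_l, Rmult_1_r. }
  assert (exr : ex_series (fun k => rhs_term (S k))).
  { revert exh. apply ex_series_ext. intros k. now rewrite Hrhs. }
  set (l := hurwitz_zeta alpha (1 + z) + (1 - INR b) * Series (fun k => rhs_term (S k))).
  enough (Hl : is_series (fun k => lhs_term (S k)) l).
  { split; [eexists; exact Hl|]. split; [exact exr|]. now apply is_series_unique. }
  (* The sum may start at n = 0, as s_b(0) = 0 kills that term, whatever [Rpower] returns at base 0
     when z = 0. *)
  apply is_series_drop_zero.
  { rewrite Hlhs, digit_sum_0. simpl. ring. }
  apply (is_lim_seq_monotone_subseq _ (fun L => (b ^ L)%nat)).
  - intros N. rewrite psum_succ.
    (* N = 0 is separate because the monotonicity of u needs a positive base and z may be 0. *)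
    enough (0 <= lhs_term N) by lra. destruct N as [|N].
    { rewrite Hlhs, digit_sum_0. simpl. lra. }
    rewrite Hlhs. apply Rmult_le_pos; [apply pos_INR|].
    assert (u (S (S N)) <= u (S N)); [|lra]. unfold u.
    pose proof (pos_INR N). rewrite !S_INR. apply Rpower_decr; lra.
  - intros L. apply Nat.pow_lt_mono_r; lia.
  - apply (is_lim_seq_ext (fun L => (psum lhs_term (b ^ L)
      - (h 0%nat - (INR b - 1) * psum (fun k => h (S k)) L))
      + (h 0%nat - (INR b - 1) * psum (fun k => h (S k)) L))).
    { intros L. ring. }
    replace (Finite l) with
      (Finite (0 + (h 0%nat - (INR b - 1) * Series (fun k => h (S k))))).
    2: { f_equal. unfold l. rewrite Hh0.
         rewrite (Series_ext (fun k => rhs_term (S k)) (fun k => h (S k))) by auto. ring. }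
    apply is_lim_seq_plus'.
    + apply is_lim_seq_dominated with
        (fun L => (2 + (1 + z) / Rabs (alpha - 1)) * rho ^ L + (INR b - 1) * (INR L * rho ^ L)).
      * intros L.
        rewrite (psum_ext lhs_term (fun n => INR (digit_sum b n) * (u n - u (S n)))) by auto.
        eapply Rle_trans; [apply psum_digit_sum_error; assumption|].
        apply Req_le. unfold rho. ring.
      * replace (Finite 0) with (Finite ((2 + (1 + z) / Rabs (alpha - 1)) * 0 + (INR b - 1) * 0))
          by (f_equal; ring).
        apply is_lim_seq_plus'.
        -- apply (is_lim_seq_scal_l _ _ 0), is_lim_seq_geom. rewrite Rabs_pos_eq; lra.
        -- apply (is_lim_seq_scal_l _ _ 0), is_lim_seq_INR_geom, Hrho.
    + apply is_lim_seq_minus'; [apply is_lim_seq_const|].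
      apply (is_lim_seq_scal_l _ _ (Series (fun k => h (S k)))).
      apply is_series_psum, Series_correct, exh.
Qed.
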